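(* Every planar graph with no $4$-cycle (as a subgraph) is $(5,5)$-colorable, i.e., its vertex set can be partitioned into two parts each inducing a subgraph of maximum degree at most $5$.
   Context: All graphs are finite and simple. *)

(* Defs.v *)
From HB Require Import structures.
From mathcomp Require Import all_boot all_order all_algebra.
From mathcomp Require Import all_classical all_reals all_analysis.

Set Implicit Arguments.
Unset Strict Implicit.
Unset Printing Implicit Defensive.

Import Order.TTheory GRing.Theory Num.Theory.
Import numFieldNormedType.Exports.

Local Open Scope classical_set_scope.
Local Open Scope ring_scope.

(* Finite simple graphs are symmetric irreflexive relations on a finType. *)

(* A crossing-free drawing of e in the plane R * R. Each edge xy is drawn as a
   simple arc, parametrized from x to y by [gamma x y] on [0, 1]; only the
   values of gamma on edges and on [0, 1] matter. [gamma x y] and [gamma y x]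
   run through the same arc in opposite directions, hence the disjointness
   clause is about edges with different sets of endpoints. *)
Record plane_drawing (R : realType) (T : finType) (e : rel T)
    (p : T -> R * R) (gamma : T -> T -> R -> R * R) : Prop := PlaneDrawing {
  drawing_inj : injective p ;
  drawing_continuous : forall x y, e x y ->
    {within `[0, 1], continuous (gamma x y)} ;
  drawing_simple : forall x y, e x y ->
    {in `[0, 1] &, injective (gamma x y)} ;
  drawing_start : forall x y, e x y -> gamma x y 0 = p x ;
  drawing_end : forall x y, e x y -> gamma x y 1 = p y ;
  drawing_rev : forall x y, e x y ->
    {in `[0, 1], forall t, gamma y x t = gamma x y (1 - t)} ;
  drawing_vertex : forall x y z, e x y ->
    {in `]0, 1[, forall t, gamma x y t <> p z} ;
  drawing_disjoint : forall x y u v, e x y -> e u v ->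
    [set x; y]%SET <> [set u; v]%SET ->
    {in `]0, 1[ &, forall s t, gamma x y s <> gamma u v t}
}.

Definition planar (R : realType) (T : finType) (e : rel T) : Prop :=
  exists p gamma, @plane_drawing R T e p gamma.

(* [ucycle e c] is the closed walk condition together with [uniq c], so for
   k >= 3 these are the (not necessarily induced) k-cycles of the graph. *)
Definition has_cycle (k : nat) (T : finType) (e : rel T) : Prop :=
  exists c : k.-tuple T, ucycle e c.

Definition induced_max_degree (T : finType) (e : rel T) (A : {set T}) : nat :=
  \max_(x in A) #|[set y in A | e x y]%SET|.

Definition defective_colorable (d1 d2 : nat) (T : finType) (e : rel T) : Prop :=
  exists A B : {set T},
    [/\ (A :|: B = [set: T])%SET, (A :&: B = finset.set0)%SET,
        (induced_max_degree e A <= d1)%N & (induced_max_degree e B <= d2)%N].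

(* Main.v *)
(* The idea is to decompose the graph into a forest and a graph of maximum degree
   at most 5; a proper 2-coloring of the forest is then the required coloring.

   Let X be a set of vertices. Euler's formula, in a planar graph where every edge
   lies in at most one triangle and there is no 4-face, gives the inequality
   sum_(u in X) deg u <= 5 |X| + |N(X)|. By Hall's theorem every vertex y can
   then pick at most one neighbor so that each u is picked at least deg u - 5
   times. The picked edges form a graph with at most one cycle per component,
   and breaking the cycles costs nothing, since a vertex on a cycle of length at
   least 3 is also incident with the edge it has picked itself.

   Euler's inequality is obtained from the arcs of the drawing as follows. On a
   fine square grid, replace each vertex by a block of pixels and each edge by a
   connected set of pixels, which makes the graph a minor of the grid. In the
   grid every even edge set is the boundary of a set of unit squares; modulo 2,
   this passes to minors and gives a family of at least |E| - |V| even edge sets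
   in which each edge occurs at most twice. *)

Require Import Defs.
(* In this order, the finset names shadow those of classical_sets. *)
From mathcomp Require Import all_classical all_reals all_analysis.
From mathcomp Require Import all_boot all_order all_algebra.
From mathcomp Require Import zify lra.

Set Implicit Arguments.
Unset Strict Implicit.
Unset Printing Implicit Defensive.

Import Order.TTheory GRing.Theory Num.Theory.
Import numFieldNormedType.Exports.

(** * Cycles, cuts and minors modulo 2 *)

Section ChainsModTwo.

Local Open Scope ring_scope.

Lemma F2_addrr (x : 'F_2) : x + x = 0.
Proof. exact: addrr_pchar2 (pchar_Fp (isT : prime 2)) x. Qed.

Lemma F2_addr_eq0 (x y : 'F_2) : (x + y == 0) = (x == y).
Proof. by rewrite -[RHS]subr_eq0 (oppr_pchar2 (pchar_Fp (isT : prime 2))). Qed.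

Lemma F2_natr_odd n : n%:R = (odd n)%:R :> 'F_2.
Proof. by rewrite -modn2 Fp_nat_mod. Qed.

Lemma sum_mul_indicator (R : pzSemiRingType) (I : finType) (F : I -> R) j :
  \sum_i F i * (i == j)%:R = F j.
Proof.
rewrite (bigD1 j) //= eqxx mulr1 big1 ?addr0 // => i /negPf ->.
by rewrite mulr0.
Qed.

Definition boundary (V E : finType) (s t : E -> V) (c : E -> 'F_2) (v : V) : 'F_2 :=
  \sum_x c x * ((s x == v)%:R + (t x == v)%:R).

Definition cut (A E : Type) (f1 f2 : E -> A) (w : A -> 'F_2) (x : E) : 'F_2 :=
  w (f1 x) + w (f2 x).

Section Boundary.

Variables (V E : finType) (s t : E -> V).

Lemma boundary0 v : boundary s t (fun=> 0) v = 0.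
Proof. by rewrite /boundary big1 // => x _; rewrite mul0r. Qed.

Lemma boundaryD c c' v :
  boundary s t (fun x => c x + c' x) v = boundary s t c v + boundary s t c' v.
Proof. by rewrite -big_split; apply: eq_bigr => x _; rewrite mulrDl. Qed.

Lemma boundaryZ a c v : boundary s t (fun x => a * c x) v = a * boundary s t c v.
Proof. by rewrite /boundary mulr_sumr; apply: eq_bigr => x _; rewrite mulrA. Qed.

Lemma boundary_sum (I : finType) (c : I -> E -> 'F_2) v :
  boundary s t (fun x => \sum_i c i x) v = \sum_i boundary s t (c i) v.
Proof.
by rewrite /boundary exchange_big; apply: eq_bigr => x _; rewrite mulr_suml.
Qed.

Lemma boundary_indicator y v :
  boundary s t (fun x => (x == y)%:R) v = (s y == v)%:R + (t y == v)%:R.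
Proof. by under [LHS]eq_bigr => x _ do rewrite mulrC; rewrite sum_mul_indicator. Qed.

Lemma sum_boundary (X : {set V}) c : \sum_(v in X) boundary s t c v =
  \sum_x c x * ((s x \in X)%:R + (t x \in X)%:R).
Proof.
have sum_eq u : \sum_(v in X) (u == v)%:R = (u \in X)%:R :> 'F_2.
  rewrite big_mkcond -[RHS](sum_mul_indicator (fun v => (v \in X)%:R) u) /=.
  by apply: eq_bigr => v _; rewrite eq_sym; case: (v \in X); rewrite ?mul1r ?mul0r.
rewrite exchange_big; apply: eq_bigr => x _.
by rewrite -mulr_sumr big_split /= !sum_eq.
Qed.

Lemma ex_cycle_basis : exists m (C : 'M['F_2]_(m, #|E|)),
  [/\ row_free C, (#|E| <= #|V| + m)%N
    & forall k v, boundary s t (fun x => C k (enum_rank x)) v = 0].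
Proof.
pose incidence : 'M['F_2]_(#|E|, #|V|) :=
  \matrix_(i, j) ((s (enum_val i) == enum_val j)%:R + (t (enum_val i) == enum_val j)%:R).
exists (\rank (kermx incidence)), (row_base (kermx incidence)).
split=> [||k v]; first exact: row_base_free.
  by rewrite mxrank_ker -leq_subLR leq_sub2l // rank_leq_col.
have /matrixP /(_ k (enum_rank v)) : row_base (kermx incidence) *m incidence = 0.
  by apply/sub_kermxP; rewrite eq_row_base.
rewrite !mxE => <-; rewrite /boundary (reindex (@enum_val E E)) /=; last first.
  exact/onW_bij/enum_val_bij.
by apply: eq_bigr => i _; rewrite enum_valK [incidence _ _]mxE enum_rankK.
Qed.

End Boundary.

Definition connected_set (P : finType) (adj : rel P) (X : {set P}) : Prop :=
  {in X &, forall p q, connect [rel x y in X | adj x y] p q}.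

Section ConnectedSets.

Variables (P G : finType) (src tgt : G -> P).

Definition joins g p q : bool :=
  ((src g == p) && (tgt g == q)) || ((src g == q) && (tgt g == p)).

Definition adjacent : rel P := [rel p q | (p != q) && [exists g, joins g p q]].

Definition chain_within (X : {set P}) (c : G -> 'F_2) : Prop :=
  forall g, c g != 0 -> [/\ src g \in X, tgt g \in X & src g != tgt g].

Lemma connect_chain (X : {set P}) p q : connect [rel x y in X | adjacent x y] p q ->
  exists2 c, chain_within X c &
    forall r, boundary src tgt c r = (p == r)%:R + (q == r)%:R.
Proof.
case/connectP => s; elim: s p => [|p' s IH] p /=.
  move=> _ ->; exists (fun=> 0) => [g|r]; first by rewrite eqxx.
  by rewrite boundary0 F2_addrr.
case/andP => /andP[/andP[pX p'X] /andP[pp' /existsP[g gpp']]] /IH/[apply].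
move=> [c cX c_bd]; exists (fun h => c h + (h == g)%:R) => [h|r].
  have [-> _|_] := eqVneq h g; last by rewrite addr0; apply: cX.
  by case/orP: gpp' => /andP[/eqP-> /eqP->] //; rewrite eq_sym.
rewrite boundaryD c_bd boundary_indicator.
have -> : (src g == r)%:R + (tgt g == r)%:R = (p == r)%:R + (p' == r)%:R :> 'F_2.
  by case/orP: gpp' => /andP[/eqP-> /eqP->] //; rewrite addrC.
by rewrite addrC -addrA [X in _ + X]addrA F2_addrr add0r.
Qed.

Lemma connected_set_boundary (X : {set P}) (d : P -> 'F_2) :
  connected_set adjacent X -> (forall p, p \notin X -> d p = 0) ->
  \sum_(p in X) d p = 0 ->
  exists2 c, chain_within X c & boundary src tgt c =1 d.
Proof.
move=> X_conn d_out d_sum; have [X0|/set0Pn[r rX]] := eqVneq X set0.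
  exists (fun=> 0) => [g|p]; first by rewrite eqxx.
  by rewrite boundary0 d_out // X0 inE.
have chain_to_r p : exists c : G -> 'F_2, p \in X ->
    chain_within X c /\ forall q, boundary src tgt c q = (p == q)%:R + (r == q)%:R.
  have [pX|_] := boolP (p \in X); last by exists (fun=> 0).
  by have [c cX cE] := connect_chain (X_conn p r pX rX); exists c.
have [c cP] := fin_all_exists chain_to_r.
exists (fun g => \sum_p d p * c p g) => [g|q].
  apply: contra_neqP => cg; apply: big1 => p _.
  have [pX|/d_out->] := boolP (p \in X); last by rewrite mul0r.
  have [->|/(cP p pX).1 //] := eqVneq (c p g) 0; by rewrite mulr0.
rewrite boundary_sum.
have -> : \sum_p boundary src tgt (fun g => d p * c p g) q =
    \sum_p (d p * (p == q)%:R + d p * (r == q)%:R).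
  apply: eq_bigr => p _; rewrite boundaryZ -mulrDr.
  by have [/cP[_ ->]|/d_out->] := boolP (p \in X); rewrite ?mul0r.
rewrite big_split /= sum_mul_indicator -mulr_suml.
rewrite (bigID (mem X)) /= d_sum add0r big1 ?mul0r ?addr0 //; exact: d_out.
Qed.

End ConnectedSets.

(* The edge g of the multigraph separates the faces side1 g and side2 g; only the
   points that are not inner may have odd degree in a cut of the dual. *)
Record abstract_dual (P G : finType) (Q : Type) (src tgt : G -> P)
    (side1 side2 : G -> Q) (inner : pred P) : Prop := AbstractDual {
  cycle_is_cut : forall c : G -> 'F_2,
    (forall p, boundary src tgt c p = 0) -> (forall g, src g = tgt g -> c g = 0) ->
    exists w : Q -> 'F_2, c =1 cut side1 side2 w;
  cut_is_cycle : forall (w : Q -> 'F_2) p, inner p ->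
    boundary src tgt (cut side1 side2 w) p = 0
}.

Record minor_model (P G V E : finType) (src tgt : G -> P) (s t : E -> V)
    (region : V -> {set P}) (link : E -> G) : Prop := MinorModel {
  region_disjoint : forall u v p, p \in region u -> p \in region v -> u = v;
  region_connected : forall v, connected_set (adjacent src tgt) (region v);
  link_inj : injective link;
  link_ends : forall x,
    (src (link x) \in region (s x) /\ tgt (link x) \in region (t x)) \/
    (src (link x) \in region (t x) /\ tgt (link x) \in region (s x));
  minor_loopless : forall x, s x != t x
}.

Section Minor.

Variables (P G V E : finType) (src tgt : G -> P) (s t : E -> V).
Variables (region : V -> {set P}) (link : E -> G).
Hypothesis minor : minor_model src tgt s t region link.

Lemma mem_region u v p : p \in region u -> (p \in region v) = (u == v).
Proof.
move=> pu; apply/idP/eqP => [pv|<- //]; exact: (region_disjoint minor) pv.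
Qed.

Lemma mem_region_link x v :
  (src (link x) \in region v)%:R + (tgt (link x) \in region v)%:R =
  (s x == v)%:R + (t x == v)%:R :> 'F_2.
Proof.
by case: (link_ends minor x) => -[/mem_region-> /mem_region->]; rewrite // addrC.
Qed.

Definition internal g : bool :=
  (src g != tgt g) && [exists v, (src g \in region v) && (tgt g \in region v)].

Lemma internal_not_link x : ~~ internal (link x).
Proof.
apply/andP => -[_ /existsP[v /andP[sv tv]]].
have := minor_loopless minor x; move: sv tv.
case: (link_ends minor x) => -[/mem_region-> /mem_region->] /eqP-> /eqP->;
  by rewrite eqxx.
Qed.

Lemma link_not_loop x : src (link x) != tgt (link x).
Proof.
apply/eqP => st; have /negP := minor_loopless minor x; apply.
by case: (link_ends minor x) => -[]; rewrite st => /mem_region-> //; rewrite eq_sym.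
Qed.

Definition pushforward (c : E -> 'F_2) (g : G) : 'F_2 := \sum_x c x * (link x == g)%:R.

Lemma pushforward_link c x : pushforward c (link x) = c x.
Proof.
rewrite -[RHS](sum_mul_indicator c x); apply: eq_bigr => y _.
by rewrite (inj_eq (link_inj minor)).
Qed.

Lemma pushforward_out c g : g \notin codom link -> pushforward c g = 0.
Proof.
move=> gN; rewrite /pushforward big1 // => x _.
by case: eqP => [xg|]; rewrite ?mulr0 //; rewrite -xg codom_f in gN.
Qed.

Lemma sum_pushforward c (F : G -> 'F_2) :
  \sum_g pushforward c g * F g = \sum_x c x * F (link x).
Proof.
under eq_bigr => g _ do rewrite mulr_suml.
rewrite exchange_big; apply: eq_bigr => x _ /=.
under eq_bigr => g _ do rewrite -mulrA -(mulrC (F g)) eq_sym.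
by rewrite -mulr_sumr sum_mul_indicator.
Qed.

Lemma sum_boundary_pushforward c v :
  \sum_(p in region v) boundary src tgt (pushforward c) p = boundary s t c v.
Proof.
rewrite sum_boundary sum_pushforward.
by apply: eq_bigr => x _; rewrite mem_region_link.
Qed.

Lemma boundary_pushforward_out c p : (forall v, p \notin region v) ->
  boundary src tgt (pushforward c) p = 0.
Proof.
move=> p_out; rewrite /boundary sum_pushforward big1 // => x _.
have end_neq u v : u \in region v -> (u == p) = false.
  by move=> uv; apply: contraNF (p_out v) => /eqP<-.
by case: (link_ends minor x) => -[/end_neq-> /end_neq->]; rewrite addr0 mulr0.
Qed.

(* Inside every region, the boundary of the pushforward of c is bounded by a
   chain, because the region is connected and c is even at its vertex. *)
Lemma lift_cycle c : (forall v, boundary s t c v = 0) ->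
  exists f : G -> 'F_2, [/\ forall p, boundary src tgt f p = 0,
    forall x, f (link x) = c x & forall g, f g != 0 -> g \in codom link \/ internal g].
Proof.
move=> c_even; pose d := boundary src tgt (pushforward c).
have fill v : exists h : G -> 'F_2, chain_within src tgt (region v) h /\
    boundary src tgt h =1 fun p => (p \in region v)%:R * d p.
  have [| |h hv hE] := connected_set_boundary (region_connected minor (v := v))
      (d := fun p => (p \in region v)%:R * d p); last by exists h.
    by move=> p /negPf->; rewrite mul0r.
  rewrite -[RHS](c_even v) -sum_boundary_pushforward.
  by apply: eq_bigr => p ->; rewrite mul1r.
have {fill}[h /all_and2[hv hE]] := fin_all_exists fill.
have h_internal v g : h v g != 0 -> internal g.
  by move=> /hv[sv tv st]; rewrite /internal st; apply/existsP; exists v; rewrite sv tv.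
have sum_h0 g : ~~ internal g -> \sum_v h v g = 0.
  by move=> gN; apply: big1 => v _; apply/eqP; apply: contraNT gN; apply: h_internal.
exists (fun g => pushforward c g + \sum_v h v g); split=> [p|x|g].
- rewrite boundaryD boundary_sum.
  under [X in _ + X]eq_bigr => v _ do rewrite hE mulrC.
  have [[v pv]|pN] := altP (@existsP _ (fun v => p \in region v)).
    under [X in _ + X]eq_bigr => u _ do rewrite (mem_region _ pv) eq_sym.
    by rewrite (sum_mul_indicator (fun=> d p)) F2_addrr.
  rewrite [X in _ + X]big1 => [|v _]; last first.
    by rewrite (negPf (existsPn pN v)) mulr0.
  by rewrite addr0 boundary_pushforward_out // => v; apply: (existsPn pN).
- by rewrite pushforward_link sum_h0 ?addr0 // internal_not_link.
have [gl|gN] := boolP (g \in codom link); first by left.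
by rewrite pushforward_out // add0r => fg; right; apply: contraNT fg => /sum_h0->.
Qed.

Section Potentials.

Variables (Q : Type) (side1 side2 : G -> Q) (inner : pred P).
Hypothesis dual : abstract_dual src tgt side1 side2 inner.
Hypothesis region_inner : forall v p, p \in region v -> inner p.

(* W q lists the potentials at q of lifts of the given cycles. *)
Lemma ex_cycle_potentials m (C : 'I_m -> E -> 'F_2) :
  (forall k v, boundary s t (C k) v = 0) ->
  exists W : Q -> 'rV['F_2]_m,
    (forall x, W (side1 (link x)) + W (side2 (link x)) = \row_k C k x) /\
    (forall g, g \in codom link \/ internal g \/ W (side1 g) = W (side2 g)).
Proof.
move=> C_even.
have potential k : exists w : Q -> 'F_2,
    (forall x, cut side1 side2 w (link x) = C k x) /\
    (forall g, cut side1 side2 w g != 0 -> g \in codom link \/ internal g).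
  have [f [f_even f_link f_supp]] := lift_cycle (C_even k).
  have [//|g g_loop|w fw] := cycle_is_cut dual (c := f).
    apply/eqP/contraT => /f_supp[/codomP[x gx]|/andP[/eqP//]].
    by have := link_not_loop x; rewrite -gx g_loop eqxx.
  by exists w; split=> [x|g]; rewrite -fw; [exact: f_link | exact: f_supp].
have [w /all_and2[w_link w_supp]] := fin_all_exists potential.
exists (fun q => \row_k w k q); split=> [x|g].
  by apply/rowP => k; rewrite !mxE -w_link.
have [gl|gN] := boolP (g \in codom link); first by left.
have [|g_out] := boolP (internal g); first by right; left.
right; right; apply/rowP => k; rewrite !mxE; apply/eqP; rewrite -F2_addr_eq0.
by apply: contraT => /w_supp[]; [rewrite (negPf gN) | rewrite (negPf g_out)].
Qed.

Lemma cut_potential_even (A : Type) (W : Q -> A) :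
  (forall g, g \in codom link \/ internal g \/ W (side1 g) = W (side2 g)) ->
  forall w v, boundary s t (cut (W \o side1 \o link) (W \o side2 \o link) w) v = 0.
Proof.
move=> W_supp w v; pose c := cut side1 side2 (w \o W).
pose F g := c g * ((src g \in region v)%:R + (tgt g \in region v)%:R).
have F0 g : g \notin codom link -> F g = 0.
  move=> gN; have [gl|[/andP[_ /existsP[u /andP[su tu]]]|Wg]] := W_supp g.
  - by rewrite gl in gN.
  - by rewrite /F (mem_region _ su) (mem_region _ tu) F2_addrr mulr0.
  by rewrite /F /c /cut /= Wg F2_addrr mul0r.
transitivity (\sum_g F g); last first.
  rewrite -sum_boundary big1 // => p /region_inner; exact: (cut_is_cycle dual).
transitivity (\sum_x 1 * F (link x)).
  by apply: eq_bigr => x _; rewrite mul1r /F mem_region_link.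
rewrite -(sum_pushforward (fun=> 1)); apply: eq_bigr => g _.
have [/codomP[x ->]|/F0->] := boolP (g \in codom link); last by rewrite mulr0.
by rewrite pushforward_link mul1r.
Qed.

End Potentials.

End Minor.

Definition separated_faces (E A : finType) (f1 f2 : E -> A) : {set A} :=
  [set y | [exists x, (f1 x != f2 x) && (y \in [:: f1 x; f2 x])]].

Lemma rank_le_separated_faces (E : finType) m (C : 'M['F_2]_(m, #|E|))
    (f1 f2 : E -> 'rV['F_2]_m) :
  (forall x, f1 x + f2 x = \row_k C k (enum_rank x)) ->
  (\rank C <= #|separated_faces f1 f2|)%N.
Proof.
move=> C_diff; set S := separated_faces f1 f2.
pose N := \matrix_(i < #|S|) (enum_val i : 'rV['F_2]_m).
have sub_N y : y \in S -> (y <= N)%MS.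
  move=> yS; have <-: row (enum_rank_in yS y) N = y by rewrite rowK enum_rankK_in.
  exact: row_sub.
rewrite -mxrank_tr; apply: leq_trans (rank_leq_row N); apply/mxrankS/row_subP => i.
have -> : row i C^T = f1 (enum_val i) + f2 (enum_val i).
  by rewrite C_diff; apply/rowP => k; rewrite !mxE enum_valK.
have [->|neq] := eqVneq (f1 (enum_val i)) (f2 (enum_val i)).
  by rewrite (_ : _ + _ = 0) ?sub0mx //; apply/rowP => k; rewrite !mxE F2_addrr.
by apply: addmx_sub; apply: sub_N; rewrite inE; apply/existsP; exists (enum_val i);
  rewrite neq !inE eqxx ?orbT.
Qed.

(* Take a basis of the cycle space and lift it to the host; the two sides of an
   edge x carry labels that differ by the column of x in the basis, so there are
   at least as many labels as the dimension of the cycle space. *)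
Theorem minor_faces (P G V E : finType) (Q : Type) (src tgt : G -> P)
    (side1 side2 : G -> Q) (inner : pred P) (s t : E -> V)
    (region : V -> {set P}) (link : E -> G) :
  abstract_dual src tgt side1 side2 inner ->
  minor_model src tgt s t region link ->
  (forall v p, p \in region v -> inner p) ->
  exists (A : finType) (f1 f2 : E -> A),
    (forall w v, boundary s t (cut f1 f2 w) v = 0) /\
    (#|E| <= #|V| + #|separated_faces f1 f2|)%N.
Proof.
move=> dual minor region_inner; have [m [C [C_free C_dim C_even]]] := ex_cycle_basis s t.
have [W [W_link W_supp]] := ex_cycle_potentials minor dual C_even.
exists 'rV['F_2]_m, (W \o side1 \o link), (W \o side2 \o link); split.
  exact: (cut_potential_even minor dual region_inner W_supp).
apply: leq_trans C_dim _; rewrite leq_add2l -{1}(eqP C_free).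
exact: rank_le_separated_faces.
Qed.

End ChainsModTwo.

(** * The square grid *)

Section Grid.

Local Open Scope ring_scope.

Variable n : nat.

Definition ord_down (i : 'I_n) : 'I_n := Ordinal (leq_ltn_trans (leq_pred i) (ltn_ord i)).

Definition ord_ext (F : 'I_n -> 'F_2) (k : nat) : 'F_2 :=
  if insub k is Some i then F i else 0.

Lemma ord_extE F (i : 'I_n) : ord_ext F i = F i.
Proof. by rewrite /ord_ext valK. Qed.

Lemma eq_ord_ext F F' : F =1 F' -> ord_ext F =1 ord_ext F'.
Proof. by rewrite /ord_ext => FF' k; case: insub. Qed.

Lemma boundary_line F (i : 'I_n) :
  boundary ord_down id F i = (0 < i)%N%:R * F i + ord_ext F i.+1.
Proof.
have split_ends k : (ord_down k == i)%:R + (k == i)%:R =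
    (0 < i)%N%:R * (k == i)%:R + (val k == i.+1)%:R :> 'F_2.
  rewrite -!val_eqE /=; case: (nat_of_ord k) (nat_of_ord i) => [|k'] [|i'] //=;
  by rewrite ?eqSS ?mul0r ?mul1r ?addr0 ?add0r ?F2_addrr // addrC.
under [LHS]eq_bigr => k _ do rewrite split_ends mulrDr mulrCA.
rewrite big_split /= -mulr_sumr sum_mul_indicator; congr (_ + _).
rewrite /ord_ext; case: insubP => [k _ <-|iN]; first exact: sum_mul_indicator.
by apply: big1 => k _; case: eqP iN => [<-|]; rewrite ?ltn_ord ?mulr0.
Qed.

Lemma ord_ext0 F : (forall k, ord_down k = k -> F k = 0) -> ord_ext F 0 = 0.
Proof.
move=> F_loop; rewrite /ord_ext; case: insubP => // k _ k0.
by apply/F_loop/val_inj; rewrite /= k0.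
Qed.

Lemma boundary_loopless_line F (i : 'I_n) : (forall k, ord_down k = k -> F k = 0) ->
  boundary ord_down id F i = ord_ext F i + ord_ext F i.+1.
Proof.
move=> F_loop; rewrite boundary_line -(ord_extE F i).
by case: (nat_of_ord i) => [|k]; rewrite ?ord_ext0 ?mulr0 ?mul1r.
Qed.

Lemma sum_pair (R : nmodType) (I J : finType) (F : I * J -> R) :
  \sum_p F p = \sum_i \sum_j F (i, j).
Proof. by rewrite pair_bigA; apply: eq_bigr => -[]. Qed.

Definition pixel : finType := ('I_n * 'I_n)%type.
Definition grid_edge : finType := (pixel * bool)%type.

(* (p, true) joins p to its left neighbor, (p, false) to the one below; on the
   left and lower sides of the grid these are loops. *)
Definition grid_src (g : grid_edge) : pixel :=
  if g.2 then (ord_down g.1.1, g.1.2) else (g.1.1, ord_down g.1.2).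
Definition grid_tgt (g : grid_edge) : pixel := g.1.

(* The square (i, j) has upper right corner (i, j). *)
Definition grid_side1 (g : grid_edge) : nat * nat := (val g.1.1, val g.1.2).
Definition grid_side2 (g : grid_edge) : nat * nat :=
  if g.2 then (val g.1.1, (val g.1.2).+1) else ((val g.1.1).+1, val g.1.2).

Definition grid_margin (k : nat) (p : pixel) : bool :=
  [&& (k <= p.1)%N, (k <= p.2)%N, (p.1 + k < n)%N & (p.2 + k < n)%N].

Implicit Types (f : grid_edge -> 'F_2) (i j : 'I_n).

Lemma boundary_grid f i j : boundary grid_src grid_tgt f (i, j) =
  boundary ord_down id (fun k => f ((k, j), true)) i +
  boundary ord_down id (fun l => f ((i, l), false)) j.
Proof.
rewrite /boundary sum_pair; under eq_bigr => p _ do rewrite big_bool /grid_src /=.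
rewrite big_split !sum_pair /=; congr (_ + _).
  apply: eq_bigr => k _; rewrite (bigD1 j) //= big1 ?addr0 => [|l /negPf lj].
    by rewrite !xpair_eqE eqxx !andbT.
  by rewrite !xpair_eqE lj !andbF addr0 mulr0.
rewrite exchange_big; apply: eq_bigr => l _ /=.
rewrite (bigD1 i) //= big1 ?addr0 => [|k /negPf ki]; first by rewrite !xpair_eqE eqxx.
by rewrite !xpair_eqE ki addr0 mulr0.
Qed.

Lemma grid_cycle_is_cut f :
  (forall p, boundary grid_src grid_tgt f p = 0) ->
  (forall g, grid_src g = grid_tgt g -> f g = 0) ->
  exists w : nat * nat -> 'F_2, f =1 cut grid_side1 grid_side2 w.
Proof.
move=> f_even f_loop.
pose at_ b (k l : nat) := ord_ext (fun i => ord_ext (fun j => f ((i, j), b)) l) k.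
have at_E b i j : at_ b i j = f ((i, j), b) by rewrite /at_ !ord_extE.
have left_loop j k : ord_down k = k -> f ((k, j), true) = 0.
  by move=> kk; apply: f_loop; rewrite /grid_src /= kk.
have lower_loop i k : ord_down k = k -> f ((i, k), false) = 0.
  by move=> kk; apply: f_loop; rewrite /grid_src /= kk.
have balance i j : at_ true i j + at_ true i.+1 j = at_ false i j + at_ false i j.+1.
  apply/eqP; rewrite -F2_addr_eq0 -(f_even (i, j)) boundary_grid.
  rewrite !boundary_loopless_line; [|exact: lower_loop|exact: left_loop].
  rewrite /at_ !ord_extE; apply/eqP; congr (_ + _ + _).
  by apply: eq_ord_ext => k; rewrite ord_extE.
have telescope m j : \sum_(k < m) (at_ true k j + at_ true k.+1 j) = at_ true m j.
  elim: m => [|m IH]; last by rewrite big_ord_recr /= IH addrA F2_addrr add0r.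
  by rewrite big_ord0 /at_ ord_ext0 // => k kk; rewrite ord_extE left_loop.
exists (fun q => \sum_(k < q.1) at_ false k q.2) => -[[i j] [|]];
  rewrite /cut /grid_side1 /grid_side2 /= -at_E.
  rewrite -telescope -big_split; apply: eq_bigr => k _ /=.
  exact: balance (Ordinal (ltn_trans (ltn_ord k) (ltn_ord i))) j.
by rewrite big_ord_recr /= addrA F2_addrr add0r.
Qed.

Lemma grid_cut_is_cycle (w : nat * nat -> 'F_2) p : grid_margin 1 p ->
  boundary grid_src grid_tgt (cut grid_side1 grid_side2 w) p = 0.
Proof.
case: p => i j; rewrite /grid_margin /= !addn1 => /and4P[i0 j0 iS jS].
rewrite boundary_grid !boundary_line i0 j0 !mul1r.
rewrite -[i.+1]/(val (Ordinal iS)) -[j.+1]/(val (Ordinal jS)) !ord_extE.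
by rewrite /cut /grid_side1 /grid_side2 /= [X in _ + X]addrACA F2_addrr.
Qed.

Lemma grid_dual :
  abstract_dual grid_src grid_tgt grid_side1 grid_side2 (grid_margin 1).
Proof. by split; [exact: grid_cycle_is_cut | exact: grid_cut_is_cycle]. Qed.

Definition pixel_adj : rel pixel :=
  [rel p q : pixel | (`|p.1 - q.1| + `|p.2 - q.2| == 1)%N].

Lemma pixel_adj_sym : symmetric pixel_adj.
Proof.
by move=> p q; rewrite /pixel_adj /= [`|q.1 - _|%N]distnC [`|q.2 - _|%N]distnC.
Qed.

Lemma pixel_adj_adjacent : subrel pixel_adj (adjacent grid_src grid_tgt).
Proof.
move=> p q; rewrite /adjacent /=.
have joinsC g x y : joins grid_src grid_tgt g x y = joins grid_src grid_tgt g y x.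
  exact: orbC.
wlog pq : p q / (p.1 + p.2 <= q.1 + q.2)%N => [IH|].
  have [/IH //|/ltnW/IH{}IH] := leqP (p.1 + p.2) (q.1 + q.2).
  rewrite pixel_adj_sym => /IH/andP[qp /existsP[g gqp]]; rewrite eq_sym qp.
  by apply/existsP; exists g; rewrite joinsC.
case: p q pq => [i j] [k l] /= pq; rewrite /pixel_adj /= => ijkl.
rewrite xpair_eqE -!val_eqE /=.
have [[ik jl]|[ik jl]] : (i.+1 = k /\ j = l :> nat) \/ (i = k :> nat /\ j.+1 = l) by lia.
  apply/andP; split; first by lia.
  apply/existsP; exists ((k, l), true).
  by rewrite /joins /grid_src /grid_tgt /= !xpair_eqE -!val_eqE /= -ik jl !eqxx.
apply/andP; split; first by lia.
apply/existsP; exists ((k, l), false).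
by rewrite /joins /grid_src /grid_tgt /= !xpair_eqE -!val_eqE /= -jl ik !eqxx.
Qed.

End Grid.

(** * Faces of a graph *)

Section Arcs.

Variable T : finType.
Implicit Types (e r : rel T) (x y : T).

Definition nbrs r x : {set T} := [set y | r x y].

Definition arcs r : {set T * T} := [set z | r z.1 z.2].

Definition edges r : {set {set T}} := [set [set z.1; z.2] | z in arcs r].

Lemma set2_eq x y x' y' : [set x; y] = [set x'; y'] ->
  (x, y) = (x', y') \/ (x, y) = (y', x').
Proof.
move=> E.
have /set2P x_in : x \in [set x'; y'] by rewrite -E set21.
have /set2P y_in : y \in [set x'; y'] by rewrite -E set22.
have /set2P x'_in : x' \in [set x; y] by rewrite E set21.
have /set2P y'_in : y' \in [set x; y] by rewrite E set22.
by case: x_in => ?; case: y_in => ?; case: x'_in => ?; case: y'_in => ?; subst; auto.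
Qed.

Lemma set2_inj x : injective (fun y => [set x; y]).
Proof. by move=> y y' /set2_eq[[]|[->]]. Qed.

Lemma double_card_edges_le e : symmetric e -> irreflexive e -> 2 * #|edges e| <= #|arcs e|.
Proof.
move=> e_sym e_irr; rewrite -[#|arcs e|]sum1_card.
rewrite (partition_big_imset (fun z => [set z.1; z.2])) /=.
rewrite mulnC -sum_nat_const; apply: leq_sum => _ /imsetP[[x y] xy ->].
have xNy : x != y by apply: contraTneq xy => ->; rewrite inE e_irr.
have <- : #|[set (x, y); (y, x)]| = 2 by rewrite cards2 xpair_eqE (negPf xNy).
rewrite sum1dep_card; apply/subset_leq_card/subsetP => z; rewrite !inE in xy *.
by case/orP => /eqP->; rewrite /= ?[e y x]e_sym xy //= setUC.
Qed.

End Arcs.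

Definition even_subgraph (T : finType) (e r : rel T) : Prop :=
  [/\ subrel r e, symmetric r & forall x, ~~ odd #|nbrs r x|].

(* A face is represented by its boundary; the last clause is half of Euler's
   formula (arcs are ordered pairs). *)
Definition has_faces (T : finType) (e : rel T) : Prop :=
  exists (A : finType) (face : A -> rel T),
  [/\ forall a, even_subgraph e (face a),
      forall x y, #|[set a | face a x y]| <= 2 &
      #|arcs e| <= 2 * (#|T| + #|[set a | arcs (face a) != set0]|)].

Section Subdivision.

Variables (T : finType) (e : rel T).

Definition arc : finType := {z : T * T | z \in arcs e}.
Definition edge : finType := {Y : {set T} | Y \in edges e}.

Definition arc_edge (z : arc) : edge :=
  exist _ [set (val z).1; (val z).2] (imset_f (fun z => [set z.1; z.2]) (valP z)).

(* The edges of the subdivision of e are the arcs of e: (x, y) joins x to the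
   midpoint of xy. *)
Definition half_src (z : arc) : T + edge := inl (val z).1.
Definition half_tgt (z : arc) : T + edge := inr (arc_edge z).

Lemma arc_edge_inj z z' : arc_edge z = arc_edge z' -> (val z).1 = (val z').1 -> z = z'.
Proof.
move: z z' => [[x y] xy] [[x' y'] x'y'] /(congr1 val)/= E x'E; apply: val_inj => /=.
by move: E; rewrite x'E => /set2_inj->.
Qed.

Record grid_model n (region : T + edge -> {set pixel n}) : Prop := GridModel {
  model_inner : forall v p, p \in region v -> grid_margin 1 p;
  model_disjoint : forall u v p, p \in region u -> p \in region v -> u = v;
  model_connected : forall v, connected_set (@pixel_adj n) (region v);
  model_touch : forall z : arc, exists p q,
    [/\ p \in region (half_src z), q \in region (half_tgt z) & pixel_adj p q]
}.

Local Open Scope ring_scope.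

Lemma grid_model_minor n (region : T + edge -> {set pixel n}) : grid_model region ->
  exists link : arc -> grid_edge n,
    minor_model (@grid_src n) (@grid_tgt n) half_src half_tgt region link.
Proof.
move=> model; have touch_link z : exists g : grid_edge n,
    (grid_src g \in region (half_src z) /\ grid_tgt g \in region (half_tgt z)) \/
    (grid_src g \in region (half_tgt z) /\ grid_tgt g \in region (half_src z)).
  have [p [q [pz qz /pixel_adj_adjacent/andP[_ /existsP[g gpq]]]]] := model_touch model z.
  by exists g; case/orP: gpq => /andP[/eqP-> /eqP->]; [left | right].
have [link linkP] := fin_all_exists touch_link; exists link; split=> //.
- exact: (model_disjoint model).
- move=> v p q pv qv; apply: connect_sub (model_connected model pv qv) => x y /=.
  by case/andP=> xyv /pixel_adj_adjacent xy; apply/connect1/andP.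
move=> z z' E; have disj := model_disjoint model.
have halves_inj : half_src z = half_src z' -> half_tgt z = half_tgt z' -> z = z'.
  by move=> [Es] [Et]; apply: arc_edge_inj Es; apply: val_inj.
have := linkP z'; rewrite -E => -[] [sz' tz']; have [] := linkP z => -[sz tz].
- exact: halves_inj (disj _ _ _ sz sz') (disj _ _ _ tz tz').
- by have := disj _ _ _ sz sz'.
- by have := disj _ _ _ sz sz'.
exact: halves_inj (disj _ _ _ tz tz') (disj _ _ _ sz sz').
Qed.

Section FacesFromDual.

Hypothesis e_sym : symmetric e.
Hypothesis e_irr : irreflexive e.
Variables (A : finType) (f1 f2 : arc -> A).
Hypothesis faces_even : forall w v, boundary half_src half_tgt (cut f1 f2 w) v = 0.

Definition on_boundary a (z : arc) : bool := (f1 z == a) (+) (f2 z == a).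

Definition face_rel a : rel T :=
  [rel x y | [exists z, (val z == (x, y)) && on_boundary a z]].

Lemma cut_indicator a z : cut f1 f2 (fun b => (b == a)%:R) z = (on_boundary a z)%:R.
Proof.
by rewrite /cut /on_boundary; case: eqP; case: eqP; rewrite ?F2_addrr ?addr0 ?add0r.
Qed.

Lemma face_relE a z : face_rel a (val z).1 (val z).2 = on_boundary a z.
Proof.
apply/existsP/idP => [[z' /andP[/eqP E]]|za].
  by rewrite (val_inj (etrans E (esym (surjective_pairing _)))).
by exists z; rewrite -surjective_pairing eqxx.
Qed.

Lemma face_relP a x y :
  reflect (exists2 z : arc, val z = (x, y) & on_boundary a z) (face_rel a x y).
Proof.
apply: (iffP existsP) => [[z /andP[/eqP zxy za]]|[z zxy za]];
  by exists z; rewrite ?zxy ?eqxx.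
Qed.

Lemma on_boundary_rev a z z' : val z' = ((val z).2, (val z).1) ->
  on_boundary a z' = on_boundary a z.
Proof.
move=> z'E; have := faces_even (fun b => (b == a)%:R) (inr (arc_edge z)).
have zNz' : z != z'.
  apply: contraTneq (valP z) => zz'; rewrite inE.
  by move: z'E; rewrite -zz'; case: (val z) => x y [->]; rewrite e_irr.
have edge_eq y : (inr (arc_edge y) == inr (arc_edge z) :> T + edge)%:R =
    (y == z)%:R + (y == z')%:R :> 'F_2.
  have [->|yNz] := eqVneq y z; first by rewrite eqxx (negPf zNz') addr0.
  have [->|yNz'] := eqVneq y z'.
    rewrite add0r (_ : arc_edge z' = arc_edge z) ?eqxx //.
    by apply: val_inj; rewrite /= z'E setUC.
  rewrite addr0; case: eqP => // -[/set2_eq[]]; rewrite -?surjective_pairing.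
    by move/val_inj => yz; rewrite yz eqxx in yNz.
  by rewrite -z'E => /val_inj yz'; rewrite yz' eqxx in yNz'.
rewrite /boundary; under eq_bigr => y _ do rewrite edge_eq add0r mulrDr.
rewrite big_split /= !sum_mul_indicator !cut_indicator => /eqP.
by rewrite F2_addr_eq0; do 2!case: on_boundary.
Qed.

Lemma face_rel_sym a : symmetric (face_rel a).
Proof.
have face_rev u v : face_rel a u v -> face_rel a v u.
  case/face_relP=> z zuv za; have uv : (v, u) \in arcs e.
    by have := valP z; rewrite zuv !inE /= e_sym.
  apply/face_relP; exists (exist _ (v, u) uv : arc) => //.
  by rewrite (@on_boundary_rev a z) //= zuv.
by move=> x y; apply/idP/idP; apply: face_rev.
Qed.

Lemma card_nbrs_face_rel a x :
  #|nbrs (face_rel a) x| = #|[set z : arc | on_boundary a z & (val z).1 == x]|.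
Proof.
set out := [set z | _ & _].
rewrite -(card_in_imset (f := fun z : arc => (val z).2) (D := out)); last first.
  move=> z z'; rewrite !inE => /andP[_ /eqP zx] /andP[_ /eqP z'x] E; apply: val_inj.
  by rewrite [LHS]surjective_pairing [RHS]surjective_pairing zx z'x E.
apply: eq_card => y; rewrite inE; apply/face_relP/imsetP => [[z zxy za]|[z]].
  by exists z; rewrite ?inE ?za ?zxy /=.
by rewrite inE => /andP[za /eqP zx] ->; exists z; rewrite // -zx -surjective_pairing.
Qed.

Lemma face_rel_even a x : ~~ odd #|nbrs (face_rel a) x|.
Proof.
have := faces_even (fun b => (b == a)%:R) (inl x).
have -> : boundary half_src half_tgt (cut f1 f2 (fun b => (b == a)%:R)) (inl x) =
    #|nbrs (face_rel a) x|%:R.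
  rewrite card_nbrs_face_rel -sum1dep_card natr_sum [RHS]big_mkcond.
  apply: eq_bigr => z _; rewrite cut_indicator addr0 -natrM mulnb.
  by rewrite (inj_eq inl_inj); case: (_ && _).
by rewrite F2_natr_odd; case: odd.
Qed.

Lemma face_rel_even_subgraph a : even_subgraph e (face_rel a).
Proof.
split=> [x y /face_relP[z zxy _]||x]; [|exact: face_rel_sym|exact: face_rel_even].
by have := valP z; rewrite zxy inE.
Qed.

Lemma card_faces_of_arc x y : (#|[set a | face_rel a x y]| <= 2)%N.
Proof.
have [xy|xyN] := boolP ((x, y) \in arcs e); last first.
  rewrite (_ : [set a | _] = set0) ?cards0 //; apply/setP => a; rewrite !inE.
  by apply: contraNF xyN => /face_relP[z <- _]; exact: valP.
pose z : arc := exist _ (x, y) xy.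
apply: (@leq_trans #|[set f1 z; f2 z]|); last by rewrite cards2; case: eqP.
apply/subset_leq_card/subsetP => a; rewrite !inE (face_relE a z) /on_boundary.
by rewrite ![a == _]eq_sym; case: eqP; case: eqP.
Qed.

Lemma separated_faces_nonempty :
  separated_faces f1 f2 = [set a | arcs (face_rel a) != set0].
Proof.
apply/setP => a; rewrite !inE; apply/existsP/set0Pn => [[z /andP[neq az]]|[[x y]]].
  exists (val z); rewrite inE face_relE /on_boundary.
  move: az; rewrite !inE => /orP[]/eqP->; last by rewrite eqxx (negPf neq).
  by rewrite eqxx eq_sym (negPf neq).
rewrite inE => /face_relP[z _ za]; exists z; move: za.
rewrite /on_boundary !inE ![a == _]eq_sym.
have [->|_] := eqVneq (f1 z) (f2 z); first by rewrite addbb.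
by case: eqP; case: eqP.
Qed.

Lemma dual_has_faces :
  (#|arc| <= #|{: T + edge}| + #|separated_faces f1 f2|)%N -> has_faces e.
Proof.
rewrite card_sum !card_sig separated_faces_nonempty => euler.
exists A, face_rel; split; [exact: face_rel_even_subgraph | exact: card_faces_of_arc |].
have := double_card_edges_le e_sym e_irr; move: euler.
rewrite -[#|[pred x in arcs e]|]/#|arcs e| -[#|[pred x in edges e]|]/#|edges e|.
by move: #|arcs e| #|edges e| #|_| #|_|; lia.
Qed.

End FacesFromDual.

Theorem grid_model_has_faces n (region : T + edge -> {set pixel n}) :
  symmetric e -> irreflexive e -> grid_model region -> has_faces e.
Proof.
move=> e_sym e_irr model; have [link minor] := grid_model_minor model.
have [A [f1 [f2 [even euler]]]] := minor_faces (@grid_dual n) minor (model_inner model).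
exact: (dual_has_faces e_sym e_irr even euler).
Qed.

End Subdivision.

(** * Euler's inequality for graphs without 4-cycles *)

Definition relI (T : Type) (r q : rel T) : rel T := [rel x y | r x y && q x y].

Section ArcCounting.

Variable T : finType.
Implicit Types r q : rel T.

Lemma card_arcs r : #|arcs r| = \sum_x #|nbrs r x|.
Proof.
rewrite -sum1dep_card; under [RHS]eq_bigr => x _ do rewrite -sum1dep_card.
by rewrite pair_big_dep.
Qed.

Lemma eq_card_arcs r q : r =2 q -> #|arcs r| = #|arcs q|.
Proof. by move=> rq; apply: eq_card => z; rewrite !inE rq. Qed.

Lemma subrel_card_arcs r q : subrel r q -> #|arcs r| <= #|arcs q|.
Proof. by move=> rq; apply/subset_leq_card/subsetP => z; rewrite !inE; apply: rq. Qed.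

Lemma card_arcs_flip r : #|arcs [rel x y | r y x]| = #|arcs r|.
Proof.
rewrite !card_arcs; under eq_bigr => x _ do rewrite -sum1dep_card big_mkcond.
rewrite exchange_big; apply: eq_bigr => y _.
by rewrite -sum1dep_card [RHS]big_mkcond.
Qed.

Lemma card_arcsU r q : (forall x y, r x y -> ~~ q x y) ->
  #|arcs (relU r q)| = #|arcs r| + #|arcs q|.
Proof.
move=> rq; rewrite -cardsUI [X in _ + #|pred_of_set X|](_ : _ = set0) ?cards0 ?addn0.
  by apply: eq_card => z; rewrite !inE.
by apply/setP => z; rewrite !inE; apply/andP => -[/rq/negP].
Qed.

Lemma double_size_le_arcs r (s : seq T) : uniq s ->
  {in s, forall x, 1 < #|nbrs r x|} -> 2 * size s <= #|arcs r|.
Proof.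
move=> s_uniq s_deg; rewrite mulnC -(card_uniqP s_uniq) -sum_nat_const.
rewrite card_arcs big_mkcond /=.
by apply: leq_sum => x _; case: ifP => // /s_deg.
Qed.

Lemma sum_card_arcs_cover (A : finType) (F : {set A}) (face : A -> rel T) k q :
  (forall x y, #|[set a | face a x y]| <= k) ->
  \sum_(a in F) #|arcs (relI (face a) q)| <= k * #|arcs q|.
Proof.
move=> cover; under eq_bigr => a _ do rewrite -sum1dep_card big_mkcond.
rewrite exchange_big mulnC -sum_nat_const [leqRHS]big_mkcond /=.
apply: leq_sum => z _.
rewrite inE /relI /=; case: (q _ _); last by rewrite big1 // => a _; rewrite andbF.
apply: leq_trans (cover z.1 z.2).
rewrite -sum1dep_card [leqLHS]big_mkcond [leqRHS]big_mkcond /=.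
by apply: leq_sum => a _; rewrite andbT; case: (a \in F).
Qed.

End ArcCounting.

Definition C4_free (T : finType) (e : rel T) : Prop :=
  forall x y z w, e x y -> e y z -> e z w -> e w x -> x != z -> y == w.

Definition in_triangle (T : finType) (e : rel T) : rel T :=
  [rel x y | e x y && [exists w, e x w && e y w]].

Lemma in_triangle_sym (T : finType) (e : rel T) :
  symmetric e -> symmetric (in_triangle e).
Proof.
move=> e_sym x y; rewrite /in_triangle /= e_sym; congr (_ && _).
by apply: eq_existsb => w; rewrite andbC.
Qed.

Section EulerBound.

Variables (T : finType) (e : rel T).
Hypothesis e_irr : irreflexive e.

Lemma irreflexive_neq x y : e x y -> x != y.
Proof. by apply: contraTneq => ->; rewrite e_irr. Qed.

Lemma even_subgraph_deg_gt1 r x y : even_subgraph e r -> r x y -> 1 < #|nbrs r x|.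
Proof.
case=> _ _ r_even xy; have : 0 < #|nbrs r x| by apply/card_gt0P; exists y; rewrite inE.
by have := r_even x; case: #|_| => [|[]].
Qed.

Lemma even_subgraph_other_nbr r x y : even_subgraph e r -> r x y ->
  exists2 z, r x z & z != y.
Proof.
move=> r_even xy; have : 0 < #|nbrs r x :\ y|.
  by have := even_subgraph_deg_gt1 r_even xy; rewrite (cardsD1 y) inE xy.
by case/card_gt0P=> z; rewrite !inE => /andP[zy xz]; exists z.
Qed.

Lemma triangle_card_arcs r x y z : subrel r e -> symmetric r ->
  r x y -> r y z -> r x z -> 6 <= #|arcs (relI r (in_triangle e))|.
Proof.
move=> re r_sym xy yz xz; have neq u v : r u v -> u != v by move/re/irreflexive_neq.
have yx : r y x by rewrite r_sym.
have zx : r z x by rewrite r_sym.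
have zy : r z y by rewrite r_sym.
have tri u v w : r u v -> r u w -> r v w -> r u v && in_triangle e u v.
  move=> uv uw vw; rewrite uv /in_triangle /= re //=.
  by apply/existsP; exists w; rewrite !re.
have deg2 u v w : r u v -> r u w -> r v w ->
    1 < #|nbrs (relI r (in_triangle e)) u|.
  move=> uv uw vw; have wv : r w v by rewrite r_sym.
  apply/card_gt1P; exists v, w; rewrite !inE.
  by split; [exact: tri uw vw | exact: tri uv wv | exact: neq].
apply: (@double_size_le_arcs _ _ [:: x; y; z]) => [|u].
  by rewrite /= !inE negb_or !neq.
rewrite !inE => /or3P[]/eqP->.
- exact: deg2 xy xz yz.
- exact: deg2 yx yz xz.
exact: deg2 zx zy xy.
Qed.

Hypothesis e_C4 : C4_free e.

(* Besides y and z, neighbors of x, the boundary contains another neighbor v of y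
   and another neighbor w of z: without triangles these are five vertices. *)
Lemma even_subgraph_card_arcs r : even_subgraph e r -> arcs r != set0 ->
  6 <= #|arcs (relI r (in_triangle e))| \/ 10 <= #|arcs r|.
Proof.
move=> r_even; have [re r_sym _] := r_even.
have other := even_subgraph_other_nbr r_even.
case/set0Pn => -[x y]; rewrite inE /= => xy; have [z xz zy] := other _ _ xy.
have [yz|yz] := boolP (r y z).
  by left; apply: triangle_card_arcs re r_sym xy yz xz.
have yx : r y x by rewrite r_sym.
have zx : r z x by rewrite r_sym.
have [v yv vx] := other _ _ yx; have [w zw wx] := other _ _ zx; right.
have vw : v != w.
  apply: contraNneq zy => vw; have vz : r v z by rewrite r_sym vw.
  rewrite eq_sym in vx; rewrite eq_sym.
  exact: e_C4 (re _ _ xy) (re _ _ yv) (re _ _ vz) (re _ _ zx) vx.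
have neq a b : r a b -> a != b by move/re/irreflexive_neq.
have yw : y != w by apply: contraNneq yz => ->; rewrite r_sym.
have zv : z != v by apply: contraNneq yz => ->.
apply: (@double_size_le_arcs _ _ [:: x; y; z; v; w]) => [|u].
  by rewrite /= !inE !negb_or (neq _ _ xy) (neq _ _ xz) (eq_sym x v) vx (eq_sym x w) wx
    (eq_sym y z) zy (neq _ _ yv) yw zv (neq _ _ zw) vw.
have deg_gt1 a b : r a b -> 1 < #|nbrs r a| by apply: even_subgraph_deg_gt1.
have vy : r v y by rewrite r_sym.
have wz : r w z by rewrite r_sym.
rewrite !inE => /or4P[|||/orP[]] /eqP->; [exact: deg_gt1 xy | exact: deg_gt1 yx
  | exact: deg_gt1 zx | exact: deg_gt1 vy | exact: deg_gt1 wz].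
Qed.

Theorem euler_bound : has_faces e ->
  9 * #|arcs e| <= 30 * #|T| + 4 * #|arcs (in_triangle e)|.
Proof.
case=> A [face [face_even cover euler]]; set F := [set a | _] in euler.
have face_size : \sum_(a in F) 30 <=
    \sum_(a in F) (3 * #|arcs (relI (face a) e)|
      + 2 * #|arcs (relI (face a) (in_triangle e))|).
  apply: leq_sum => a; rewrite inE => /(even_subgraph_card_arcs (face_even a)).
  have [face_e _ _] := face_even a.
  have : #|arcs (face a)| <= #|arcs (relI (face a) e)|.
    by apply: subrel_card_arcs => x y xy; rewrite /relI /= xy face_e.
  have : #|arcs (relI (face a) (in_triangle e))| <= #|arcs (face a)|.
    by apply: subrel_card_arcs => x y /andP[].
  by move: #|_| #|_| #|_|; lia.
have := sum_card_arcs_cover F e cover.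
have := sum_card_arcs_cover F (in_triangle e) cover.
move: face_size euler; rewrite sum_nat_const big_split /= -!big_distrr /=.
by move: #|F| #|arcs e| #|T| #|_| (\sum_(_ in _) _) (\sum_(_ in _) _); lia.
Qed.

End EulerBound.

(** * Hall's condition *)

Definition hereditary_faces (T : finType) (e : rel T) : Prop :=
  forall (T' : finType) (i : T' -> T) (e' : rel T'), injective i ->
  symmetric e' -> (forall x y, e' x y -> e (i x) (i y)) -> has_faces e'.

Definition nbhd (T : finType) (e : rel T) (X : {set T}) : {set T} :=
  \bigcup_(u in X) nbrs e u.

Section ArcsPreimage.

Variables (T T' : finType) (i : T' -> T) (r : rel T).
Hypothesis i_inj : injective i.

Let pair_inj : injective (fun z : T' * T' => (i z.1, i z.2)).
Proof. by move=> [a b] [c d] [/i_inj-> /i_inj->]. Qed.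

Lemma card_arcs_relpre_le : #|arcs (relpre i r)| <= #|arcs r|.
Proof.
rewrite -(card_imset _ pair_inj); apply/subset_leq_card/subsetP => _ /imsetP[z zr ->].
by rewrite !inE in zr *.
Qed.

Lemma card_arcs_relpre : (forall x y, r x y -> x \in codom i /\ y \in codom i) ->
  #|arcs (relpre i r)| = #|arcs r|.
Proof.
move=> r_codom; apply/eqP; rewrite eqn_leq card_arcs_relpre_le /=.
rewrite -(card_imset _ pair_inj); apply/subset_leq_card/subsetP => -[x y].
rewrite inE /= => xy.
have [/codomP[a xa] /codomP[b yb]] := r_codom _ _ xy.
by rewrite xa yb in xy *; apply/imsetP; exists (a, b); rewrite ?inE.
Qed.

End ArcsPreimage.

Section HallCondition.

Variables (T : finType) (e : rel T).
Hypothesis e_sym : symmetric e.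
Hypothesis e_irr : irreflexive e.
Hypothesis e_C4 : C4_free e.
Hypothesis e_faces : hereditary_faces e.

Lemma euler_bound_on (Y : {set T}) (e' : rel T) : symmetric e' ->
  (forall x y, e' x y -> e x y /\ x \in Y) ->
  9 * #|arcs e'| <= 30 * #|Y| + 4 * #|arcs (in_triangle e')|.
Proof.
move=> e'_sym e'P; pose V := {x | x \in Y}; pose e'' : rel V := relpre val e'.
have arcs_eq : #|arcs e''| = #|arcs e'|.
  apply: card_arcs_relpre => [|x y xy]; first exact: val_inj.
  have [_ xY] := e'P _ _ xy.
  have [_ yY] : e y x /\ y \in Y by apply: e'P; rewrite e'_sym.
  by split; apply/codomP; [exists (exist _ x xY) | exists (exist _ y yY)].
have triangles_le : #|arcs (in_triangle e'')| <= #|arcs (in_triangle e')|.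
  apply: leq_trans (card_arcs_relpre_le (in_triangle e') (@val_inj _ _ V)).
  apply: subrel_card_arcs => x y /andP[xy /existsP[w xyw]].
  by rewrite /= /in_triangle /= [e' _ _]xy; apply/existsP; exists (val w).
have YE : #|{: V}| = #|Y| by rewrite card_sig; apply: eq_card.
have : 9 * #|arcs e''| <= 30 * #|{: V}| + 4 * #|arcs (in_triangle e'')|.
  apply: euler_bound.
  - by move=> x; apply/negP => /e'P[]; rewrite e_irr.
  - move=> x y z w /e'P[xy _] /e'P[yz _] /e'P[zw _] /e'P[wx _].
    exact: (e_C4 xy yz zw wx).
  apply: (@e_faces V val) => [|x y|x y /e'P[] //]; [exact: val_inj | exact: e'_sym].
by rewrite arcs_eq YE => /leq_trans-> //; rewrite leq_add2l leq_mul2l.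
Qed.

Variable X : {set T}.

Definition inner_adj : rel T := [rel x y in X | e x y].

Definition outer_adj : rel T := [rel y u | [&& y \notin X, u \in X & e y u]].

(* By C4-freeness the neighbors in X of an outer vertex y induce a matching;
   from each of its edges only the end of smaller rank is kept by y. *)
Definition drops (y u : T) : bool :=
  [exists v, [&& outer_adj y v, e u v & enum_rank v < enum_rank u]].

Definition dropped_adj : rel T := [rel y u | outer_adj y u && drops y u].

Definition kept_adj : rel T := [rel y u | outer_adj y u && ~~ drops y u].

Definition heavy : {set T} := [set y | 1 < #|nbrs kept_adj y|].

Definition spoke : rel T := [rel y u | (y \in heavy) && kept_adj y u].

(* No triangle of this graph leaves X, so that its Euler bound charges nothing for
   triangles to the spokes. *)
Definition thinned : rel T := [rel x y | [|| inner_adj x y, spoke x y | spoke y x]].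

Lemma inner_adj_sym : symmetric inner_adj.
Proof. by move=> x y; rewrite /inner_adj /= e_sym; congr (_ && _); rewrite andbC. Qed.

Lemma sum_deg_split : \sum_(u in X) #|nbrs e u| =
  #|arcs inner_adj| + #|arcs dropped_adj| + #|arcs kept_adj|.
Proof.
have -> : \sum_(u in X) #|nbrs e u| = #|arcs [rel u y | (u \in X) && e u y]|.
  rewrite card_arcs big_mkcond; apply: eq_bigr => u _.
  have [uX|/negPf uX] := boolP (u \in X); last rewrite (_ : nbrs _ u = set0) ?cards0 //.
    by apply: eq_card => y; rewrite !inE /= uX.
  by apply/setP => y; rewrite !inE /= uX.
rewrite -addnA -card_arcsU => [|y u]; last first.
  by rewrite /kept_adj /= => /andP[_ ->]; rewrite andbF.
rewrite -[X in _ + X]card_arcs_flip -card_arcsU => [|u y].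
  apply: eq_card_arcs => u y; rewrite /inner_adj /dropped_adj /kept_adj /outer_adj /=.
  rewrite -andb_orr orbN andbT [e y u]e_sym.
  by case: (u \in X); case: (y \in X); rewrite ?orbF ?orbT.
by rewrite /inner_adj /dropped_adj /kept_adj /outer_adj /= => /andP[/andP[_ ->]].
Qed.

Lemma card_kept_le : #|arcs kept_adj| + #|heavy| <= #|nbhd e X :\: X| + #|arcs spoke|.
Proof.
rewrite !card_arcs -!sum1_card [X in _ + X <= _]big_mkcond [X in _ <= X + _]big_mkcond /=.
rewrite -!big_split /=; apply: leq_sum => y _.
have spoke_eq : y \in heavy -> #|nbrs spoke y| = #|nbrs kept_adj y|.
  by move=> yh; apply: eq_card => u; rewrite !inE /spoke /= yh.
have kept_nbhd : 0 < #|nbrs kept_adj y| -> y \in nbhd e X :\: X.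
  case/card_gt0P=> u; rewrite inE => /andP[/and3P[yX uX yu] _]; rewrite in_setD yX.
  by apply/bigcupP; exists u; rewrite // inE e_sym.
case: ifPn spoke_eq => [yh ->//|yh _]; rewrite inE in yh.
  by rewrite kept_nbhd ?(ltnW yh) // addnC.
rewrite -leqNgt in yh; rewrite addn0; case: posnP kept_nbhd => [->//|_ -> //].
exact: leq_trans yh (leq_addr _ _).
Qed.

Lemma double_card_heavy_le : 2 * #|heavy| <= #|arcs spoke|.
Proof.
rewrite cardE; apply: double_size_le_arcs => [|y]; first exact: enum_uniq.
rewrite mem_enum => yh; move: (yh); rewrite inE => /leq_trans-> //.
by apply/subset_leq_card/subsetP => u; rewrite !inE /spoke /= yh.
Qed.

Definition lonely_adj : rel T :=
  [rel x y | inner_adj x y && ~~ in_triangle inner_adj x y].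

Lemma card_inner_split : #|arcs inner_adj| =
  #|arcs (in_triangle inner_adj)| + #|arcs lonely_adj|.
Proof.
rewrite -card_arcsU => [|x y xy]; last by rewrite /lonely_adj /= xy andbF.
apply: eq_card_arcs => x y; rewrite /lonely_adj /in_triangle /=.
by case: (inner_adj x y) => //=; rewrite orbN.
Qed.

Lemma outer_edge_unique y y' u v : outer_adj y u -> outer_adj y v ->
  outer_adj y' u -> outer_adj y' v -> e u v -> y = y'.
Proof.
move=> /and3P[_ _ yu] /and3P[_ _ yv] /and3P[_ _ y'u] /and3P[_ _ y'v] uv.
rewrite e_sym in y'u; rewrite e_sym in yv.
apply/eqP; apply: contraLR uv => yy'.
by have /eqP-> := e_C4 yu y'u y'v yv yy'; rewrite e_irr.
Qed.

Lemma outer_edge_lonely y u v : outer_adj y u -> outer_adj y v -> e u v -> lonely_adj u v.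
Proof.
move=> /and3P[yX uX yu] /and3P[_ vX yv] uv; rewrite /lonely_adj /inner_adj /= uX vX uv /=.
apply: contraL uv => /andP[_ /existsP[w /andP[/andP[/andP[_ wX] uw] /andP[_ vw]]]].
have yw : y != w by apply: contraNneq yX => ->.
rewrite e_sym in yv; rewrite e_sym in vw.
by have /eqP-> := e_C4 yu uw vw yv yw; rewrite e_irr.
Qed.

(* An arc (y, u) dropped because of the edge uv of X is charged to uv, which lies
   in no triangle of X and has no other outer neighbor, both by C4-freeness. *)
Lemma double_card_dropped_le : 2 * #|arcs dropped_adj| <= #|arcs lonely_adj|.
Proof.
pose descending := [rel x y | lonely_adj x y && (enum_rank y < enum_rank x)].
have lonely_sym : symmetric lonely_adj.
  move=> x y; rewrite /lonely_adj /= inner_adj_sym in_triangle_sym //.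
  exact: inner_adj_sym.
have double_descending : 2 * #|arcs descending| <= #|arcs lonely_adj|.
  rewrite mul2n -addnn -[X in _ + X]card_arcs_flip -card_arcsU => [|x y /=].
    by apply: subrel_card_arcs => x y /= /orP[]/andP[]; rewrite // lonely_sym.
  by case/andP=> _ xy; rewrite negb_and -leqNgt (ltnW xy) orbT.
apply: leq_trans double_descending; rewrite leq_mul2l /=.
have partner_ex z : exists v, z \in arcs dropped_adj ->
    [/\ outer_adj z.1 z.2, outer_adj z.1 v, e z.2 v & enum_rank v < enum_rank z.2].
  have [/andP[yu /existsP[v /and3P[yv uv vu]]]|zN] := boolP (dropped_adj z.1 z.2).
    by exists v.
  by exists z.1; rewrite inE (negPf zN).
have [partner partnerP] := fin_all_exists partner_ex.
rewrite -(card_in_imset (f := fun z => (z.2, partner z)) (D := arcs dropped_adj)).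
  apply/subset_leq_card/subsetP => _ /imsetP[z /partnerP[yu yv uv vu] ->].
  by rewrite inE /= vu andbT; apply: outer_edge_lonely yu yv uv.
move=> [y u] [y' u'] /partnerP[/= yu yv uv _] /partnerP[/= y'u' y'v _ _] [uu' vv'].
rewrite -vv' in y'v; rewrite -uu' in y'u' *; congr (_, _).
exact: outer_edge_unique yu yv y'u' y'v uv.
Qed.

Lemma card_inner_triangles_le :
  #|arcs (in_triangle inner_adj)| <= 6 * #|X :&: nbhd e X|.
Proof.
have : 9 * #|arcs inner_adj| <=
    30 * #|X :&: nbhd e X| + 4 * #|arcs (in_triangle inner_adj)|.
  apply: euler_bound_on inner_adj_sym _ => x y /andP[/andP[xX yX] xy].
  by split=> //; rewrite inE xX; apply/bigcupP; exists y; rewrite // inE e_sym.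
by rewrite card_inner_split; lia.
Qed.

Lemma spoke_outer y u : spoke y u -> outer_adj y u.
Proof. by case/and3P. Qed.

Lemma thinned_sym : symmetric thinned.
Proof. by move=> x y; rewrite /thinned /= inner_adj_sym; congr (_ || _); exact: orbC. Qed.

Lemma thinned_edge x y : thinned x y -> e x y /\ x \in X :|: heavy.
Proof.
rewrite inE; case/or3P=> [/andP[/andP[-> _] ->]|xy|/spoke_outer/and3P[_ -> yx]] //.
  by case/and3P: (spoke_outer xy) => _ _ ->; case/andP: xy => ->; rewrite orbT.
by rewrite e_sym.
Qed.

Lemma card_thinned : #|arcs thinned| = #|arcs inner_adj| + 2 * #|arcs spoke|.
Proof.
have spoke_out x y : spoke x y -> (x \notin X) /\ (y \in X).
  by move=> /spoke_outer/and3P[].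
rewrite mul2n -addnn -[X in _ + (_ + X)]card_arcs_flip.
rewrite -card_arcsU => [|x y /spoke_out[xX _]].
  rewrite -card_arcsU // => x y /andP[/andP[xX yX] _]; apply/negP => /orP[] /spoke_out[];
  by rewrite ?xX ?yX.
by apply/negP => /spoke_out[_]; rewrite (negPf xX).
Qed.

Lemma thinned_triangle_inner x y z :
  thinned x y -> thinned x z -> thinned y z -> x \in X.
Proof.
move=> xy xz yz; apply: contraT => xX.
have kept u : thinned x u -> kept_adj x u.
  case/or3P=> [/andP[/andP[x_in]]|/andP[_ //]|/spoke_outer/and3P[_ x_in]];
  by rewrite x_in in xX.
have [/andP[xy_out y_kept] /andP[xz_out z_kept]] := (kept _ xy, kept _ xz).
have [yz_e _] := thinned_edge yz.
have zy_e : e z y by rewrite e_sym.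
have [lt|lt|/val_inj/enum_rank_inj yz_eq] := ltngtP (enum_rank y) (enum_rank z).
- by case/existsP: z_kept; exists y; rewrite xy_out zy_e.
- by case/existsP: y_kept; exists z; rewrite xz_out yz_e.
by rewrite yz_eq e_irr in yz_e.
Qed.

Lemma card_thinned_triangles_le :
  #|arcs (in_triangle thinned)| <= #|arcs (in_triangle inner_adj)|.
Proof.
apply: subrel_card_arcs => x y /andP[xy /existsP[z /andP[xz yz]]].
have [yx zx zy] : [/\ thinned y x, thinned z x & thinned z y].
  by split; rewrite thinned_sym.
have xX := thinned_triangle_inner xy xz yz; have yX := thinned_triangle_inner yx yz xz.
have zX := thinned_triangle_inner zx zy xy.
have [[xy_e _] [xz_e _] [yz_e _]] :=
  And3 (thinned_edge xy) (thinned_edge xz) (thinned_edge yz).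
rewrite /in_triangle /inner_adj /= xX yX xy_e; apply/existsP; exists z.
by rewrite zX xz_e yz_e.
Qed.

Lemma card_spokes_le : 9 * (#|arcs inner_adj| + 2 * #|arcs spoke|) <=
  30 * (#|X| + #|heavy|) + 4 * #|arcs (in_triangle inner_adj)|.
Proof.
rewrite -card_thinned; apply: leq_trans (euler_bound_on thinned_sym thinned_edge) _.
rewrite leq_add ?leq_mul2l ?card_thinned_triangles_le //.
by rewrite -cardsUI leq_addr.
Qed.

Theorem hall_condition : \sum_(u in X) #|nbrs e u| <= 5 * #|X| + #|nbhd e X|.
Proof.
have <- : #|X :&: nbhd e X| + #|nbhd e X :\: X| = #|nbhd e X| by rewrite setIC cardsID.
rewrite sum_deg_split.
have := card_kept_le; have := double_card_heavy_le; have := double_card_dropped_le.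
have := card_inner_triangles_le; have := card_spokes_le; have := card_inner_split.
by lia.
Qed.

End HallCondition.

(** * Hall's theorem *)

Section HallMarriage.

Variables D V : finType.
Implicit Types (N : D -> {set V}) (A S : {set D}) (Y : {set V}).

Definition targets N S : {set V} := \bigcup_(d in S) N d.

Definition hall_cond A N : Prop := forall S, S \subset A -> #|S| <= #|targets N S|.

Definition matching A N (f : D -> V) : Prop :=
  {in A &, injective f} /\ {in A, forall d, f d \in N d}.

Lemma targets_setD N Y S : targets (fun d => N d :\: Y) S = targets N S :\: Y.
Proof.
apply/setP => v; rewrite inE; apply/bigcupP/andP => [[d dS]|[vY /bigcupP[d dS vd]]].
  by rewrite inE => /andP[-> vd]; split=> //; apply/bigcupP; exists d.
by exists d; rewrite // inE vY.
Qed.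

Lemma hall_cond_tight A N S : hall_cond A N -> S \subset A ->
  #|targets N S| <= #|S| -> hall_cond (A :\: S) (fun d => N d :\: targets N S).
Proof.
move=> hall SA tight S'; rewrite subsetD => /andP[S'A disj]; rewrite targets_setD.
have := hall (S' :|: S); rewrite subUset S'A SA => /(_ isT).
rewrite cardsU disjoint_setI0 // cards0 subn0.
rewrite /targets bigcup_setU -/(targets N S) -/(targets N S').
have := cardsUI (targets N S') (targets N S).
have := cardsID (targets N S) (targets N S').
by lia.
Qed.

Lemma hall_cond_slack A N d v : d \in A ->
  (forall S, S != set0 -> S \proper A -> #|S| < #|targets N S|) ->
  hall_cond (A :\ d) (fun x => N x :\: [set v]).
Proof.
move=> dA slack S SAd; have [->|S0] := eqVneq S set0; first by rewrite cards0.
have SA : S \proper A := sub_proper_trans SAd (properD1 dA).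
have := slack S S0 SA; rewrite targets_setD (cardsD1 v (targets N S)).
by case: (v \in _) => // /ltnW.
Qed.

Lemma matching_glue A N S Y f g : S \subset A ->
  matching S N f -> {in S, forall d, f d \in Y} ->
  matching (A :\: S) (fun d => N d :\: Y) g ->
  matching A N (fun d => if d \in S then f d else g d).
Proof.
move=> SA [f_inj fN] fY [g_inj gN].
have g_out d : d \in A -> d \notin S -> g d \notin Y /\ g d \in N d.
  by move=> dA dS; have := gN d; rewrite !inE dS dA => /(_ isT)/andP.
split=> [d d' dA d'A|d dA]; last first.
  by case: ifPn => [/fN //|dS]; have [] := g_out d dA dS.
case: ifPn => dS; case: ifPn => d'S E.
- exact: f_inj.
- by have [] := g_out d' d'A d'S; rewrite -E fY.
- by have [] := g_out d dA dS; rewrite E fY.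
by apply: g_inj; rewrite // inE ?dS ?d'S.
Qed.

(* Induction on A, splitting off a tight proper subset if there is one, and
   otherwise one element with an arbitrary partner. *)
Theorem hall_marriage (v0 : V) A N : hall_cond A N -> exists f, matching A N f.
Proof.
have [k] := ubnP #|A|; elim: k => // k IH in A N * => /ltnSE Ak hall.
have [->|/set0Pn[d dA]] := eqVneq A set0.
  by exists (fun=> v0); split=> [x y|x]; rewrite inE.
have [/existsP[S /and3P[S0 SA tight]]|no_tight] :=
    boolP [exists S, [&& S != set0, S \proper A & #|targets N S| <= #|S|]].
  have [||f [f_inj fN]] := IH S N; first exact: leq_trans (proper_card SA) Ak.
    by move=> S' S'S; apply/hall/subset_trans/proper_sub/SA.
  have [||g g_match] := IH (A :\: S) (fun d => N d :\: targets N S).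
  - apply: leq_trans Ak; rewrite cardsD (setIidPr (proper_sub SA)).
    by rewrite ltn_subrL !card_gt0 S0; apply/set0Pn; exists d.
  - exact: hall_cond_tight hall (proper_sub SA) tight.
  eexists; apply: matching_glue (proper_sub SA) (conj f_inj fN) _ g_match.
  by move=> x xS; apply/bigcupP; exists x; rewrite ?fN.
have /card_gt0P[v vd] : 0 < #|N d|.
  by have := hall [set d]; rewrite sub1set dA cards1 /targets big_set1 => /(_ isT).
have [||g g_match] := IH (A :\ d) (fun x => N x :\: [set v]).
- by move: Ak; rewrite (cardsD1 d A) dA.
- apply: hall_cond_slack dA _ => S S0 SA; move/existsPn/(_ S): no_tight.
  by rewrite S0 SA /= -ltnNge.
eexists; apply: (matching_glue (S := [set d]) (f := fun=> v)) _ _ g_match.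
- by rewrite sub1set.
- by split=> [x y|x] /set1P-> // /set1P->.
by move=> x _; rewrite set11.
Qed.

End HallMarriage.

Lemma card_ord_lt m j : j <= m -> #|[set i : 'I_m | i < j]| = j.
Proof. by move=> jm; rewrite -sum1dep_card (big_ord_narrow jm) sum1_card card_ord. Qed.

(* Apply Hall's theorem to b d copies of each d. *)
Theorem hall_assignment (D V : finType) (b : D -> nat) (N : D -> {set V}) :
  (forall S : {set D}, \sum_(d in S) b d <= #|targets N S|) ->
  exists g : V -> option D, (forall v d, g v = Some d -> v \in N d) /\
    (forall d, b d <= #|[set v | g v == Some d]|).
Proof.
move=> hall; have [v0 _|V0] := pickP (fun _ : V => true); last first.
  exists (fun=> None); split=> // d; have := hall [set d]; rewrite big_set1.
  by move/leq_trans; apply; apply/subset_leq_card/subsetP => v; have := V0 v.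
pose m := \max_d b d; have b_le_m d : b d <= m by apply: leq_bigmax.
pose A := [set z : D * 'I_m | z.2 < b z.1].
have card_copies X : #|[set z in A | z.1 \in X]| = \sum_(d in X) b d.
  rewrite -sum1dep_card; under [RHS]eq_bigr => d _.
    rewrite -(card_ord_lt (b_le_m d)) -sum1dep_card; over.
  by rewrite pair_big_dep; apply: eq_bigl => z; rewrite inE andbC.
have [S SA|f [f_inj fN]] := hall_marriage (A := A) (N := N \o fst) v0.
  apply: leq_trans (leq_trans (hall [set z.1 | z in S]) _).
    rewrite -card_copies; apply/subset_leq_card/subsetP => z zS.
    by rewrite inE (subsetP SA) ?imset_f.
  apply/subset_leq_card/subsetP => v /bigcupP[_ /imsetP[z zS ->] vz].
  by apply/bigcupP; exists z.
exists (fun v => omap fst [pick z in A | f z == v]); split=> [v d|d].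
  by case: pickP => //= z /andP[zA /eqP<-] [<-]; apply: fN.
rewrite -(card_ord_lt (b_le_m d)) -(card_in_imset (f := fun i => f (d, i))); last first.
  by move=> i j; rewrite !inE => iA jA /f_inj; rewrite !inE => /(_ iA jA)[].
apply/subset_leq_card/subsetP => _ /imsetP[i iA ->]; rewrite inE in iA; rewrite inE.
have dA : (d, i) \in A by rewrite inE.
case: pickP => [z /andP[zA /eqP/f_inj->] //|/(_ (d, i))]; by rewrite dA eqxx.
Qed.

(** * Coloring *)

Section FunctionalGraph.

Variables (T : finType) (g : T -> T).

Definition reached_by_all (K : {set T}) : bool :=
  [forall y, [exists z in K, fconnect g y z]].

Lemma reached_by_allP (K : {set T}) :
  reflect (forall y, exists2 z, z \in K & fconnect g y z) (reached_by_all K).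
Proof. by apply: (iffP forallP) => reach y; apply/exists_inP. Qed.

Lemma ex_orbit_transversal :
  exists2 K : {set T}, reached_by_all K & {in K &, forall y z, fconnect g y z -> y = z}.
Proof.
have [|K K_min] := @ex_minset _ reached_by_all.
  by exists setT; apply/reached_by_allP => y; exists y; rewrite ?inE ?connect0.
exists K; first exact: minsetp K_min.
have /reached_by_allP reach := minsetp K_min.
move=> y z yK zK yz; apply: contraTeq yK => yNz.
have -> : K = K :\ y; last by rewrite !inE eqxx.
apply/esym/(minsetinf K_min); last exact: subsetDl.
apply/reached_by_allP => x; have [w wK xw] := reach x.
have [wy|wy] := eqVneq w y; last by exists w; rewrite // !inE wy.
by exists z; rewrite ?inE 1?eq_sym ?yNz //; apply: connect_trans yz; rewrite -wy.
Qed.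

Lemma ex_level (K : {set T}) : reached_by_all K ->
  exists d : T -> nat,
    {in K, forall y, d y = 0} /\ {in ~: K, forall y, d y = (d (g y)).+1}.
Proof.
move/reached_by_allP=> reach; have hit y : exists n, iter n g y \in K.
  by have [z zK yz] := reach y; exists (findex g y z); rewrite iter_findex.
exists (fun y => ex_minn (hit y)); split=> y yK.
  by case: ex_minnP => m _ /(_ 0 yK); rewrite leqn0 => /eqP.
rewrite inE in yK; case: ex_minnP => -[|m]; first by rewrite /= (negPf yK).
rewrite iterSr => mK m_min; case: ex_minnP => m' m'K m'_min; apply/eqP.
by rewrite eqSS eqn_leq m'_min // andbT -ltnS m_min // iterSr.
Qed.

End FunctionalGraph.

Section PickColoring.

Variables (T : finType) (e : rel T) (g : T -> T).
Hypothesis e_irr : irreflexive e.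
Hypothesis g_edge : forall y, g y != y -> e y (g y).

(* Only an arc y -> g y with y in K can be monochromatic; then u = g y has no
   other such neighbor, and its own arc to g u makes up for y. *)
Lemma card_picked_le (K : {set T}) (d : T -> nat) :
  reached_by_all g K -> {in K &, forall y z, fconnect g y z -> y = z} ->
  {in K, forall y, d y = 0} -> {in ~: K, forall y, d y = (d (g y)).+1} ->
  forall u, #|[set y in nbrs e u | g y == u]| <=
            #|[set y in nbrs e u | odd (d y) != odd (d u)]|.
Proof.
move=> /reached_by_allP reach K_transversal d0 dS u.
set pickers := [set y in _ | g y == u].
set opposite := [set y in _ | odd _ != _].
have [z zK uz] := reach u.
have pickers_out y : y \in pickers -> y \notin opposite -> y = z /\ y \in K.
  rewrite !inE => /andP[-> /eqP gy] /=; have [yK _|yK] := boolP (y \in K); last first.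
    by rewrite (dS y) ?inE // gy /=; case: odd.
  split=> //; apply: K_transversal => //; apply: connect_trans uz.
  by rewrite -gy fconnect1.
have [/subset_leq_card //|/subsetPn[y0 y0_picks y0_same]] :=
  boolP (pickers \subset opposite).
have [y0z y0K] := pickers_out _ y0_picks y0_same.
have uy0 : e u y0 by move: y0_picks; rewrite !inE => /andP[].
have du_even : odd (d u) = false.
  by move: y0_same; rewrite !inE uy0 (d0 _ y0K) /= negbK => /eqP<-.
have uK : u \notin K.
  apply: contraL uy0 => uK; rewrite y0z -(K_transversal u z) //.
  by rewrite e_irr.
have du := dS u; rewrite inE uK in du; have {}du := du isT.
have gu_odd : odd (d (g u)) by move: du_even; rewrite du /= => /negbFE.
have gu_opposite : g u \in opposite.
  rewrite !inE gu_odd du_even andbT g_edge //.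
  by apply/eqP => gu; move: gu_odd; rewrite gu du_even.
have gu_not_picker : g u \notin pickers.
  rewrite !inE; apply/negP => /andP[_ /eqP ggu]; have := dS (g u); rewrite inE ggu du.
  suff guK : g u \notin K by move/(_ guK); lia.
  by apply: contraL gu_odd => guK; rewrite d0.
have sub : g u |: (pickers :\ y0) \subset opposite.
  apply/subsetP => y /setU1P[-> //|/setD1P[yNy0 y_picks]]; apply: contraNT yNy0.
  by move=> /(pickers_out _ y_picks)[-> _]; rewrite y0z.
apply: leq_trans (subset_leq_card sub).
by rewrite cardsU1 in_setD1 (negPf gu_not_picker) andbF (cardsD1 y0 pickers) y0_picks.
Qed.

(* Color by the parity of the distance along g to a transversal of its orbits. *)
Theorem pick_coloring k :
  (forall u, #|nbrs e u| <= k + #|[set y in nbrs e u | g y == u]|) ->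
  exists c : T -> bool, forall u, #|[set y in nbrs e u | c y == c u]| <= k.
Proof.
move=> g_picks; have [K K_reached K_transversal] := ex_orbit_transversal g.
have [d [d0 dS]] := ex_level K_reached; exists (odd \o d) => u /=.
have := card_picked_le K_reached K_transversal d0 dS u; have := g_picks u.
rewrite -(cardsID [set y | odd (d y) == odd (d u)] (nbrs e u)).
rewrite (_ : nbrs e u :\: _ = [set y in nbrs e u | odd (d y) != odd (d u)]); last first.
  by apply/setP => y; rewrite !inE andbC.
rewrite (_ : nbrs e u :&: _ = [set y in nbrs e u | odd (d y) == odd (d u)]); last first.
  by apply/setP => y; rewrite !inE.
by lia.
Qed.

End PickColoring.

Lemma sum_subn_card (T : finType) (X : {set T}) (f : T -> nat) k :
  \sum_(u in X) (f u - k) + k * #|[set u in X | k <= f u]| =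
  \sum_(u in [set u in X | k <= f u]) f u.
Proof.
rewrite mulnC -sum_nat_const (bigID (fun u => k <= f u)) /=.
rewrite [X in _ + X + _]big1 ?addn0 => [|u /andP[_]]; last first.
  by rewrite -ltnNge => /ltnW/eqP.
rewrite (eq_bigl [in [set u in X | k <= f u]]) => [|u]; last by rewrite inE.
by rewrite -big_split; apply: eq_bigr => u; rewrite inE => /andP[_ ku] /=; rewrite subnK.
Qed.

Theorem hereditary_faces_coloring (T : finType) (e : rel T) :
  symmetric e -> irreflexive e -> C4_free e -> hereditary_faces e ->
  exists c : T -> bool, forall u, #|[set y in nbrs e u | c y == c u]| <= 5.
Proof.
move=> e_sym e_irr e_C4 e_faces.
have [X|g [g_nbr g_count]] :=
    hall_assignment (b := fun u => #|nbrs e u| - 5) (N := nbrs e).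
  pose X5 := [set u in X | 5 <= #|nbrs e u|].
  have : #|nbhd e X5| <= #|targets (nbrs e) X|.
    apply/subset_leq_card/subsetP => y /bigcupP[u]; rewrite inE => /andP[uX _] uy.
    by apply/bigcupP; exists u.
  have := hall_condition e_sym e_irr e_C4 e_faces X5.
  by have /= := sum_subn_card X (fun u => #|nbrs e u|) 5; rewrite -/X5; lia.
pose pick y := odflt y (g y).
apply: (@pick_coloring T e pick e_irr) => [y|u].
  rewrite /pick; case gy: (g y) => [u|]; last by rewrite eqxx.
  by have := g_nbr y u gy; rewrite inE e_sym.
rewrite -leq_subLR; apply: leq_trans (g_count u) _; apply/subset_leq_card/subsetP => y.
by rewrite !inE => /eqP gy; have := g_nbr y u gy; rewrite inE => ->; rewrite /pick gy /=.
Qed.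

(** * Discrete drawings *)

Section ConnectedStrips.

Variables (P : finType) (adj : rel P).
Hypothesis adj_sym : symmetric adj.
Implicit Types (X Y S Q : {set P}).

Definition touches X S : Prop := exists p q, [/\ p \in X, q \in S & adj p q].

Lemma connect_in_subset X Y p q : X \subset Y ->
  connect [rel x y in X | adj x y] p q -> connect [rel x y in Y | adj x y] p q.
Proof.
move/subsetP=> XY; apply: connect_sub => x y /andP[/andP[xX yX] xy].
by apply: connect1; rewrite /= !XY.
Qed.

Lemma connected_set_star X r :
  {in X, forall p, connect [rel x y in X | adj x y] p r} -> connected_set adj X.
Proof.
move=> X_star p q /X_star pr /X_star.
rewrite (sym_connect_sym (e := [rel x y in X | adj x y])).
  exact: connect_trans.
by move=> x y /=; rewrite adj_sym; congr (_ && _); rewrite andbC.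
Qed.

Lemma connected_set1 p : connected_set adj [set p].
Proof. by move=> x y /set1P-> /set1P->; apply: connect0. Qed.

Lemma connected_setU1 S p q : connected_set adj S -> p \in S -> adj p q ->
  connected_set adj (q |: S).
Proof.
move=> S_conn pS pq; apply: (connected_set_star (r := p)) => x /setU1P[->|xS].
  by apply: connect1; rewrite /= setU11 setU1r // adj_sym.
exact: connect_in_subset (subsetUr _ _) (S_conn x p xS pS).
Qed.

(* Follow the path from X to Y: after its last visit to X and before its first
   visit to Y it runs through the required strip. *)
Lemma ex_strip Q X Y p q : (forall x y, x \in X -> y \in Y -> x != y /\ ~~ adj x y) ->
  connect [rel x y in Q | adj x y] p q -> p \in X -> q \in Y ->
  exists S,
    [/\ S \subset Q :\: (X :|: Y), connected_set adj S, touches X S & touches Y S].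
Proof.
move=> XY_far /connectP[s p_path ->] pX.
pose strip_at x := exists S,
  [/\ S \subset Q :\: (X :|: Y), connected_set adj S, touches X S & x \in S].
have : p \in X \/ strip_at p by left.
elim: s p {pX} p_path => [|p' s IH] p /=.
  move=> _ [pX pY|[S [SQ _ _ pS]] pY]; first by have [] := XY_far _ _ pX pY; rewrite eqxx.
  by have := subsetP SQ p pS; rewrite !inE pY orbT.
case/andP=> /andP[/andP[pQ p'Q] pp'] p'_path p_in s_end.
have [p'X|p'X] := boolP (p' \in X); first by apply: IH p'_path _ s_end; left.
have [p'Y|p'Y] := boolP (p' \in Y).
  case: p_in => [pX|[S [SQ S_conn SX pS]]].
    by have [] := XY_far _ _ pX p'Y; rewrite pp'.
  by exists S; split=> //; exists p', p; rewrite adj_sym.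
have p'_free : p' \in Q :\: (X :|: Y) by rewrite !inE (negPf p'X) (negPf p'Y).
apply: IH p'_path _ s_end; right; case: p_in => [pX|[S [SQ S_conn SX pS]]].
  exists [set p']; rewrite sub1set set11; split=> //; first exact: connected_set1.
  by exists p, p'; rewrite set11.
exists (p' |: S); split; last exact: setU11.
- by rewrite subUset sub1set p'_free.
- exact: connected_setU1 pp'.
by have [x [y [xX yS xy]]] := SX; exists x, y; rewrite setU1r.
Qed.

End ConnectedStrips.

Section PixelBalls.

Variable n : nat.
Implicit Types (p q : pixel n) (k : nat).

Definition pixel_close k : rel (pixel n) :=
  [rel p q : pixel n | (`|p.1 - q.1| <= k)%N && (`|p.2 - q.2| <= k)%N].

Definition pixel_ball k q : {set pixel n} := [set p | pixel_close k p q].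

Lemma ord_step (i j : 'I_n) : i != j ->
  exists2 i' : 'I_n, `|i - i'|%N = 1 & `|i' - j| < `|i - j|.
Proof.
rewrite -val_eqE /= neq_ltn => /orP[ij|ij].
  by exists (Ordinal (leq_ltn_trans ij (ltn_ord j))) => /=; lia.
by exists (ord_down i) => /=; lia.
Qed.

Lemma pixel_ball_connected k q : connected_set (@pixel_adj n) (pixel_ball k q).
Proof.
apply: (connected_set_star (@pixel_adj_sym n) (r := q)) => p.
have [d] := ubnP (`|p.1 - q.1| + `|p.2 - q.2|); elim: d p => // d IH p pd p_in.
have step p' : pixel_adj p p' -> p' \in pixel_ball k q ->
    `|p'.1 - q.1| + `|p'.2 - q.2| < d ->
    connect [rel x y in pixel_ball k q | pixel_adj x y] p q.
  move=> pp' p'_in p'd; apply: connect_trans (IH p' p'd p'_in).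
  by apply: connect1; rewrite /= p_in p'_in pp'.
case: p q {IH} pd p_in step => [p1 p2] [q1 q2] /=.
rewrite inE => pd /andP[/= pq1 pq2] step.
have [pq1_eq|/ord_step[i pi iq]] := eqVneq p1 q1; last first.
  by apply: (step (i, p2)); rewrite ?inE /pixel_close /pixel_adj /=; lia.
have [pq2_eq|/ord_step[j pj jq]] := eqVneq p2 q2; last first.
  by apply: (step (p1, j)); rewrite ?inE /pixel_close /pixel_adj /=; lia.
by rewrite pq1_eq pq2_eq connect0.
Qed.

Definition tube (s : seq (pixel n)) : {set pixel n} := [set p | has (pixel_close 1 p) s].

Lemma pixel_closexx k p : pixel_close k p p.
Proof. by rewrite /pixel_close /= !subrr. Qed.

Lemma pixel_close_sym k : symmetric (pixel_close k).
Proof. by move=> p q; rewrite /pixel_close /= [`|q.1 - _|]distnC [`|q.2 - _|]distnC. Qed.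

Lemma pixel_close_trans k l p q r :
  pixel_close k p q -> pixel_close l q r -> pixel_close (k + l) p r.
Proof.
case: p q r => [p1 p2] [q1 q2] [r1 r2] /andP[/= pq1 pq2] /andP[/= qr1 qr2].
by rewrite /pixel_close /=; lia.
Qed.

Lemma grid_margin_close k l p q :
  grid_margin (k + l) p -> pixel_close k p q -> grid_margin l q.
Proof.
case: p q => [p1 p2] [q1 q2] /and4P[/= p1l p2l p1u p2u] /andP[/= pq1 pq2].
by rewrite /grid_margin /=; lia.
Qed.

Lemma walk_connect_tube p s : path (pixel_close 1) p s ->
  connect [rel x y in tube (p :: s) | pixel_adj x y] p (last p s).
Proof.
elim: s p => [|q s IH] p /=; first by rewrite connect0.
case/andP=> pq /IH; move: (last q s) => r qr; apply: (@connect_trans _ _ q).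
  apply: (connect_in_subset (X := pixel_ball 1 p)).
    by apply/subsetP => x; rewrite !inE => px; apply/orP; left.
  by apply: pixel_ball_connected; rewrite inE ?pixel_closexx // pixel_close_sym.
by apply: connect_in_subset qr; apply/subsetP => x; rewrite !inE => /= ->; rewrite orbT.
Qed.

End PixelBalls.

(* c x is the pixel of the point x, the center of a block of radius r.+1, and
   c x :: w x y a walk of pixels along the edge xy; steps may be diagonal. *)
Record discrete_drawing (T : finType) (e : rel T) (n r : nat) (c : T -> pixel n)
    (w : T -> T -> seq (pixel n)) : Prop := DiscreteDrawing {
  walk_path : forall x y, e x y -> path (pixel_close 1) (c x) (w x y);
  walk_last : forall x y, e x y -> last (c x) (w x y) = c y;
  walk_margin : forall x y q, e x y -> q \in c x :: w x y -> grid_margin 2 q;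
  center_margin : forall x, grid_margin r.+2 (c x);
  center_far : forall x y, pixel_close (2 * r + 3) (c x) (c y) -> x = y;
  walk_avoids : forall x y z q, e x y -> q \in c x :: w x y ->
    pixel_close r.+2 q (c z) -> z \in [set x; y];
  walks_apart : forall x y u v q q', e x y -> e u v -> [set x; y] <> [set u; v] ->
    q \in c x :: w x y -> q' \in c u :: w u v -> pixel_close 2 q q' ->
    exists z, pixel_close r q (c z)
}.

Section DiscreteDrawing.

Variables (T : finType) (e : rel T) (n r : nat) (c : T -> pixel n).
Variable w : T -> T -> seq (pixel n).
Hypothesis e_irr : irreflexive e.
Hypothesis drawing : discrete_drawing e r c w.

Let block x := pixel_ball r.+1 (c x).

Lemma blocks_far x y p q : x != y -> p \in block x -> q \in block y ->
  p != q /\ ~~ pixel_adj p q.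
Proof.
move=> xNy; rewrite !inE pixel_close_sym => px qy.
have not_close : ~~ pixel_close 1 p q.
  apply: contra xNy => pq; apply/eqP/(center_far drawing).
  by have := pixel_close_trans (pixel_close_trans px pq) qy; congr pixel_close; lia.
split; first by apply: contraNneq not_close => ->; exact: pixel_closexx.
apply: contra not_close; case: p q {px qy} => [p1 p2] [q1 q2].
by rewrite /pixel_adj /pixel_close /=; lia.
Qed.

Lemma ex_edge_strip x y : e x y -> exists S : {set pixel n},
  [/\ S \subset tube (c x :: w x y) :\: (block x :|: block y),
      connected_set (@pixel_adj n) S,
      touches (@pixel_adj n) (block x) S & touches (@pixel_adj n) (block y) S].
Proof.
move=> xy; apply: (ex_strip (@pixel_adj_sym n) (p := c x) (q := c y)).
- by move=> p q; apply: blocks_far; apply: contraTneq xy => ->; rewrite e_irr.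
- by rewrite -(walk_last drawing xy); apply: walk_connect_tube (walk_path drawing xy).
- by rewrite inE pixel_closexx.
by rewrite inE pixel_closexx.
Qed.

Lemma tube_block_end x y z p : e x y -> p \in tube (c x :: w x y) -> p \in block z ->
  z \in [set x; y].
Proof.
move=> xy; rewrite inE => /hasP[q q_walk pq]; rewrite inE => pz.
apply: (walk_avoids drawing xy q_walk); rewrite pixel_close_sym in pq.
exact: (pixel_close_trans pq pz).
Qed.

Lemma tubes_meet_in_block x y u v p : e x y -> e u v -> [set x; y] <> [set u; v] ->
  p \in tube (c x :: w x y) -> p \in tube (c u :: w u v) -> exists z, p \in block z.
Proof.
move=> xy uv neq; rewrite 2![p \in tube _]inE => /hasP[q q_walk pq] /hasP[q' q'_walk pq'].
have qq' : pixel_close 2 q q'.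
  by rewrite pixel_close_sym in pq; exact: (pixel_close_trans pq pq').
have [z qz] := walks_apart drawing xy uv neq q_walk q'_walk qq'.
by exists z; rewrite inE; apply: pixel_close_trans pq qz.
Qed.

Definition edge_strip (Y : {set T}) (S : {set pixel n}) : Prop := exists x y,
  [/\ e x y, Y = [set x; y],
      S \subset tube (c x :: w x y) :\: (block x :|: block y),
      connected_set (@pixel_adj n) S &
      forall z, z \in Y -> touches (@pixel_adj n) (block z) S].

Lemma edge_strip_not_block Y S p z : edge_strip Y S -> p \in S -> p \notin block z.
Proof.
move=> [x [y [xy _ /subsetP S_tube _ _]]] /S_tube.
rewrite in_setD in_setU negb_or => /andP[/andP[px py] p_tube].
apply/negP => pz; have /set2P[] := tube_block_end xy p_tube pz => zE;
  by rewrite -zE pz in px py.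
Qed.

Lemma edge_strips_disjoint Y Y' S S' p :
  edge_strip Y S -> edge_strip Y' S' -> p \in S -> p \in S' -> Y = Y'.
Proof.
move=> YS YS' pS pS'; apply/eqP/contraT => /eqP neq.
have [x [y [xy Yxy /subsetP/(_ p pS) + _ _]]] := YS.
have [u [v [uv Yuv /subsetP/(_ p pS') + _ _]]] := YS'.
rewrite Yxy Yuv in neq; rewrite !in_setD => /andP[_ p'_tube] /andP[_ p_tube].
have [z pz] := tubes_meet_in_block xy uv neq p_tube p'_tube.
by have := edge_strip_not_block z YS pS; rewrite pz.
Qed.

Theorem discrete_drawing_grid_model :
  exists region : T + edge e -> {set pixel n}, grid_model region.
Proof.
have strip (Y : edge e) : exists S, edge_strip (val Y) S.
  have /imsetP[[x y]] := valP Y; rewrite inE => xy Yxy.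
  have [S [SQ S_conn Sx Sy]] := ex_edge_strip xy.
  by exists S, x, y; split=> // z; rewrite Yxy => /set2P[]->.
have {strip}[S S_strip] := fin_all_exists strip.
exists (fun v => match v with inl x => block x | inr Y => S Y end); split.
- move=> [x|Y] p /=.
    rewrite inE pixel_close_sym; apply: (@grid_margin_close _ r.+1 1).
    by rewrite addn1; exact: (center_margin drawing).
  have [x [y [xy _ /subsetP S_tube _ _]]] := S_strip Y.
  move/S_tube; rewrite in_setD => /andP[_]; rewrite inE => /hasP[q q_walk pq].
  apply: (grid_margin_close (walk_margin drawing xy q_walk : grid_margin (1 + 1) q)).
  by rewrite pixel_close_sym.
- move=> [x|Y] [x'|Y'] p /= p_in p_in'.
  + congr inl; apply/eqP/contraT => xx'.
    by have [] := blocks_far xx' p_in p_in'; rewrite eqxx.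
  + by have := edge_strip_not_block x (S_strip Y') p_in'; rewrite p_in.
  + by have := edge_strip_not_block x' (S_strip Y) p_in; rewrite p_in'.
  by congr inr; apply/val_inj/(edge_strips_disjoint (S_strip Y) (S_strip Y') p_in p_in').
- move=> [x|Y]; first exact: pixel_ball_connected.
  by have [x [y []]] := S_strip Y.
move=> z; have [x [y [_ _ _ _ touch]]] := S_strip (arc_edge z).
by apply: touch; rewrite set21.
Qed.

End DiscreteDrawing.

(** * From a plane drawing to a discrete one *)

Definition int_close (k : nat) : rel (int * int) :=
  [rel q q' | (`|q.1 - q'.1| <= k)%N && (`|q.2 - q'.2| <= k)%N].

Lemma ex_pixel_embedding (s : seq (int * int)) (k : nat) :
  exists n (f : int * int -> pixel n), {in s, forall q, grid_margin k (f q)} /\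
    {in s &, forall q q', forall l, pixel_close l (f q) (f q') = int_close l q q'}.
Proof.
pose m := \max_(q <- s) maxn `|q.1| `|q.2|; pose n := 2 * m + 2 * k.
pose shift (z : int) := `|(z + (m + k)%N)%R|.
pose f (q : int * int) : pixel n.+1 := (inord (shift q.1), inord (shift q.2)).
have s_le q : q \in s -> `|q.1| <= m /\ `|q.2| <= m.
  by move=> qs; apply/andP; rewrite -geq_max; apply: (leq_bigmax_seq (P := predT)).
have shiftE z : `|z| <= m -> shift z < n.+1 /\ Posz (shift z) = (z + (m + k)%N)%R.
  by rewrite /shift /n; lia.
have fE q : q \in s -> [/\ Posz (f q).1 = (q.1 + (m + k)%N)%R,
    Posz (f q).2 = (q.2 + (m + k)%N)%R, `|q.1| <= m & `|q.2| <= m].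
  move=> /s_le[q1 q2]; have [[lt1 eq1] [lt2 eq2]] := (shiftE _ q1, shiftE _ q2).
  by rewrite /= !inordK.
exists n.+1, f; split=> [q /fE|q q' /fE + /fE + l]; rewrite /n.
  by case: q (f q) => [q1 q2] [i j] [] /=; rewrite /grid_margin /=; lia.
rewrite /pixel_close /int_close /= => -[-> -> _ _] [-> -> _ _].
by congr ((absz _ <= l) && (absz _ <= l)); lia.
Qed.

Section CompactSublevel.

Local Open Scope classical_set_scope.
Local Open Scope ring_scope.

Lemma compact_sublevel (R : realType) (U : topologicalType) (K O : set U) (F : U -> R) :
  compact K -> open O -> continuous F -> (forall z, K z -> F z <= 0 -> O z) ->
  \forall eta \near 0^'+, forall z, K z -> F z < eta -> O z.
Proof.
move=> K_cpt O_open F_cont F_le0.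
have [K0|/set0P K_nonempty] := eqVneq (K `&` ~` O) classical_sets.set0.
  apply: nearW => eta z Kz _; apply: contrapT => Oz.
  by have : (K `&` ~` O) z by []; rewrite K0.
have KO_cpt := compact_closedI K_cpt (open_closedC O_open).
have [z0 /set_mem[Kz0 Oz0] F_min] :=
  compact_EVT_min K_nonempty KO_cpt (continuous_subspaceT F_cont).
have Fz0 : 0 < F z0 by rewrite ltNge; apply/negP => /(F_le0 _ Kz0).
near=> eta => z Kz Fz; apply: contrapT => Oz.
have : F z0 <= F z by apply/F_min/mem_set.
apply/negP; rewrite -ltNge; apply: lt_trans Fz _; near: eta; exact: nbhs_right_lt.
Unshelve. all: by end_near. Qed.

End CompactSublevel.

Section UnitInterval.

Variable R : realType.

Local Open Scope classical_set_scope.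
Local Open Scope ring_scope.

Definition clamp (t : R) : R := Num.max 0 (Num.min 1 t).

Lemma clamp_itv t : clamp t \in `[0, 1].
Proof. by rewrite in_itv /= /clamp le_max lexx /= ge_max ler01 ge_min lexx. Qed.

Lemma clamp_id t : t \in `[0, 1] -> clamp t = t.
Proof. by rewrite in_itv /= /clamp => /andP[t0 t1]; rewrite min_r ?max_r. Qed.

Lemma clamp_continuous : continuous clamp.
Proof.
move=> t; apply: (@continuous_max R R (cst 0) (Num.min 1)); first exact: cst_continuous.
by apply: (@continuous_min R R (cst 1) id); [exact: cst_continuous | exact: cvg_id].
Qed.

Lemma continuous_comp_clamp (U : topologicalType) (g : R -> U) :
  {within `[0, 1], continuous g} -> continuous (g \o clamp).
Proof.
move=> /subspace_continuousP g_cont t; apply: cvg_comp (g_cont _ (clamp_itv t)) => A.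
rewrite /within /= => /clamp_continuous; rewrite /= nbhs_simpl /=.
by apply: filterS => s; apply; exact: clamp_itv.
Qed.

Lemma unit_itv_cases (t : R) : t \in `[0, 1] -> [\/ t = 0, t = 1 | t \in `]0, 1[].
Proof.
rewrite !in_itv /= !le_eqVlt => /andP[/predU1P[<-|t0] /predU1P[->|t1]];
  by [constructor 1 | constructor 2 | constructor 3; rewrite t0 t1].
Qed.

Lemma ex_unit_subdivision (a : R) : 0 < a -> exists ts : seq R,
  [/\ path (fun s t => `|s - t| < a) 0 ts, last 0 ts = 1
    & {in ts, forall t, t \in `[0, 1]}].
Proof.
move=> a0; pose N := (Num.truncn a^-1).+1; have N0 : 0 < N%:R :> R by rewrite ltr0n.
have Na : N%:R^-1 < a by rewrite -[a]invrK ltf_pV2 ?posrE ?invr_gt0 // truncnS_gt.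
pose t_ (i : nat) : R := i%:R / N%:R.
have t_0 : t_ 0%N = 0 by rewrite /t_ mul0r.
have steps n m : path (fun s t => `|s - t| < a) (t_ m) [seq t_ i | i <- iota m.+1 n].
  elim: n m => //= n IH m; rewrite IH andbT distrC /t_ -mulrBl -natrB // subSnn mul1r.
  by rewrite ger0_norm // invr_ge0 ler0n.
exists [seq t_ i | i <- iota 1 N]; split=> [||_ /mapP[i + ->]].
- by rewrite -t_0 steps.
- rewrite -t_0 last_map -nth_last size_iota nth_iota // add1n prednK //.
  by rewrite /t_ divff // gt_eqF.
rewrite mem_iota in_itv /= add1n ltnS => /andP[_ iN].
by rewrite /t_ divr_ge0 ?ler0n //= ler_pdivrMr // mul1r ler_nat.
Qed.

Lemma dist_continuous (U : topologicalType) (V : normedModType R) (f g : U -> V) :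
  continuous f -> continuous g -> continuous (fun z => `|f z - g z|).
Proof.
move=> f_cont g_cont z; apply: cvg_norm.
by apply: cvgB; [exact: f_cont | exact: g_cont].
Qed.

End UnitInterval.

Section Lattice.

Variable R : realType.

Local Open Scope ring_scope.

Definition lattice (h : R) (q : R * R) : int * int :=
  (Num.floor (q.1 / h), Num.floor (q.2 / h)).

Lemma floor_dist_le (a b : R) (k : nat) :
  `|a - b| < k%:R -> (`|(Num.floor a - Num.floor b)%R| <= k)%N.
Proof.
have /andP[a1 a2] := floor_itv a; have /andP[b1 b2] := floor_itv b.
rewrite ltr_norml => /andP[lo hi].
have : Num.floor a < Num.floor b + 1 + k%:Z by rewrite -(ltr_int R) intrD; lra.
have : Num.floor b < Num.floor a + 1 + k%:Z by rewrite -(ltr_int R) intrD; lra.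
by lia.
Qed.

Lemma dist_lt_floor (a b : R) (k : nat) :
  (`|(Num.floor a - Num.floor b)%R| <= k)%N -> `|a - b| < k.+1%:R.
Proof.
have := floor_itv a; have := floor_itv b; rewrite !intrD => /andP[b1 b2] /andP[a1 a2] ab.
have : Num.floor a <= Num.floor b + k%:Z by lia.
have : Num.floor b <= Num.floor a + k%:Z by lia.
rewrite -!(ler_int R) !intrD -natr1 ltr_norml => ? ?.
by apply/andP; split; lra.
Qed.

Lemma lattice_close (h : R) (q q' : R * R) (k : nat) : 0 < h ->
  `|q - q'| < k%:R * h -> int_close k (lattice h q) (lattice h q').
Proof.
move=> h0; have scale (a b : R) : `|a - b| < k%:R * h -> `|a / h - b / h| < k%:R.
  by rewrite -mulrBl normrM normfV (gtr0_norm h0) ltr_pdivrMr.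
rewrite prod_normE gt_max => /andP[/scale d1 /scale d2].
by apply/andP; split; apply: floor_dist_le.
Qed.

Lemma close_lattice (h : R) (q q' : R * R) (k : nat) : 0 < h ->
  int_close k (lattice h q) (lattice h q') -> `|q - q'| < k.+1%:R * h.
Proof.
move=> h0; have scale (a b : R) : `|a / h - b / h| < k.+1%:R -> `|a - b| < k.+1%:R * h.
  by rewrite -mulrBl normrM normfV (gtr0_norm h0) ltr_pdivrMr.
move=> /andP[/dist_lt_floor/scale d1 /dist_lt_floor/scale d2].
by rewrite prod_normE gt_max d1 d2.
Qed.

End Lattice.

Section DrawingDiscretization.

Variables (R : realType) (T : finType) (e : rel T).
Variables (p : T -> R * R) (gamma : T -> T -> R -> R * R).
Hypothesis drawing : plane_drawing e p gamma.

Local Open Scope classical_set_scope.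
Local Open Scope ring_scope.

Let curve x y : R -> R * R := gamma x y \o @clamp R.

Lemma curve_continuous x y : e x y -> continuous (curve x y).
Proof.
by move=> xy; apply: continuous_comp_clamp; exact: (drawing_continuous drawing).
Qed.

Lemma curve0 x y : e x y -> curve x y 0 = p x.
Proof.
by move=> xy; rewrite /curve /= clamp_id ?(drawing_start drawing) // bound_itvE.
Qed.

Lemma curve1 x y : e x y -> curve x y 1 = p y.
Proof.
by move=> xy; rewrite /curve /= clamp_id ?(drawing_end drawing) // bound_itvE.
Qed.

Lemma curve_open x y t : t \in `]0, 1[ -> curve x y t = gamma x y t.
Proof. by move=> t01; rewrite /curve /= clamp_id // (subset_itv_oo_cc t01). Qed.

Lemma curve_vertex x y z t :
  e x y -> t \in `[0, 1] -> curve x y t = p z -> z \in [set x; y]%SET.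
Proof.
move=> xy /unit_itv_cases[->|->|t01]; rewrite ?curve0 ?curve1 //.
- by move=> /(drawing_inj drawing)->; rewrite set21.
- by move=> /(drawing_inj drawing)->; rewrite set22.
by rewrite curve_open // => /(drawing_vertex drawing xy t01).
Qed.

Lemma curves_meet_at_vertex x y u v s t :
  e x y -> e u v -> [set x; y]%SET <> [set u; v]%SET ->
  s \in `[0, 1] -> t \in `[0, 1] -> curve x y s = curve u v t ->
  exists z, curve x y s = p z.
Proof.
move=> xy uv neq /unit_itv_cases[->|->|s01].
- by exists x; rewrite curve0.
- by exists y; rewrite curve1.
move=> /unit_itv_cases[->|->|t01].
- by move=> ->; exists u; rewrite curve0.
- by move=> ->; exists v; rewrite curve1.
by rewrite !curve_open // => /(drawing_disjoint drawing xy uv neq s01 t01).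
Qed.

Lemma vertices_gap : \forall d \near 0^'+, forall x y, `|p x - p y| < d -> x = y.
Proof.
apply: filter_forall => x; apply: filter_forall => y.
have [->|xy] := eqVneq x y; first exact: nearW.
near=> d => xyd; apply/eqP; apply: contraLR xyd => _; rewrite -leNgt ltW //.
near: d; apply: nbhs_right_lt; rewrite normr_gt0 subr_eq0.
by apply: contra xy => /eqP/(drawing_inj drawing)->.
Unshelve. all: by end_near. Qed.

Lemma curve_vertex_gap : \forall d \near 0^'+, forall x y z t, e x y -> t \in `[0, 1] ->
  `|curve x y t - p z| < d -> z \in [set x; y]%SET.
Proof.
apply: filter_forall => x; apply: filter_forall => y; apply: filter_forall => z.
have [xy|_] := boolP (e x y); last by apply: nearW.
have dist_cont : continuous (fun t => `|curve x y t - p z|).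
  by apply: dist_continuous (curve_continuous xy) _; exact: cst_continuous.
have [zxy|/negP zxy] := boolP (z \in [set x; y]%SET); first exact: nearW.
have off_curve t : [set` `[0 : R, 1]] t -> `|curve x y t - p z| <= 0 ->
    classical_sets.set0 t.
  move=> t01; rewrite normr_le0 subr_eq0 => /eqP tz; exact: zxy (curve_vertex xy t01 tz).
apply: filterS (compact_sublevel (@segment_compact R 0 1) open0 dist_cont off_curve).
by move=> d d_gap t _ t01 /(d_gap t t01).
Qed.

Let unit_square : set (R * R) := `[0, 1] `*` `[0, 1].

Let unit_square_compact : compact unit_square.
Proof. by apply: compact_setX; exact: segment_compact. Qed.

Let curve1_continuous x y : e x y -> continuous (fun st : R * R => curve x y st.1).
Proof.
move=> xy st; apply: (@continuous_comp _ _ _ fst (curve x y)); first exact: cvg_fst.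
exact: curve_continuous.
Qed.

Let curve2_continuous x y : e x y -> continuous (fun st : R * R => curve x y st.2).
Proof.
move=> xy st; apply: (@continuous_comp _ _ _ snd (curve x y)); first exact: cvg_snd.
exact: curve_continuous.
Qed.

Let dist_curves_continuous x y u v : e x y -> e u v ->
  continuous (fun st : R * R => `|curve x y st.1 - curve u v st.2|).
Proof.
move=> xy uv.
by apply: dist_continuous; [exact: curve1_continuous | exact: curve2_continuous].
Qed.

Lemma curves_meet_gap (d : R) : 0 < d -> \forall eta \near 0^'+, forall x y u v s t,
  e x y -> e u v -> [set x; y]%SET <> [set u; v]%SET -> s \in `[0, 1] -> t \in `[0, 1] ->
  `|curve x y s - curve u v t| < eta -> exists z, `|curve x y s - p z| < d.
Proof.
move=> d0; apply: filter_forall => x; apply: filter_forall => y.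
apply: filter_forall => u; apply: filter_forall => v.
have [xy|_] := boolP (e x y); last by apply: nearW.
have [uv|_] := boolP (e u v); last by apply: nearW.
have [neq|neq] := eqVneq [set x; y]%SET [set u; v]%SET; first exact: nearW.
have vertex_open : open [set st : R * R | exists z, `|curve x y st.1 - p z| < d].
  rewrite (_ : [set _ | _] = \bigcup_z [set st : R * R | `|curve x y st.1 - p z| < d]).
    apply: bigcup_open => z _.
    apply: (@open_comp _ _ _ [set r | r < d]) => [st _|]; last exact: open_lt.
    by apply: dist_continuous; [exact: curve1_continuous | exact: cst_continuous].
  by apply/seteqP; split=> st [z]; [exists z | move=> _ ?; exists z].
have dist_cont := dist_curves_continuous xy uv.
apply: filterS (compact_sublevel unit_square_compact vertex_open dist_cont _).
  by move=> eta etaP s t _ _ _ s01 t01; apply: (etaP (s, t)).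
move=> [s t] [s01 t01] /=; rewrite normr_le0 subr_eq0 => /eqP st.
have [z ->] := curves_meet_at_vertex xy uv (elimN eqP neq) s01 t01 st.
by exists z; rewrite subrr normr0.
Qed.

Lemma curve_modulus (h : R) : 0 < h -> \forall a \near 0^'+, forall x y s t, e x y ->
  s \in `[0, 1] -> t \in `[0, 1] -> `|s - t| < a -> `|curve x y s - curve x y t| < h.
Proof.
move=> h0; apply: filter_forall => x; apply: filter_forall => y.
have [xy|_] := boolP (e x y); last by apply: nearW.
have diff_cont : continuous (fun st : R * R => `|st.1 - st.2|).
  by apply: dist_continuous => st; [exact: cvg_fst | exact: cvg_snd].
have close_open : open [set st : R * R | `|curve x y st.1 - curve x y st.2| < h].
  apply: (@open_comp _ _ _ [set r | r < h]); last exact: open_lt.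
  by move=> st _; exact: dist_curves_continuous.
apply: filterS (compact_sublevel unit_square_compact close_open diff_cont _).
  by move=> a aP s t _ s01 t01; apply: (aP (s, t)).
by move=> [s t] _ /=; rewrite normr_le0 subr_eq0 => /eqP->; rewrite subrr normr0.
Qed.

Section Mesh.

Variables (r : nat) (h a : R).
Hypotheses (h_gt0 : 0 < h) (a_gt0 : 0 < a).
Hypothesis vertices_apart : forall x y, `|p x - p y| < (2 * r + 3).+1%:R * h -> x = y.
Hypothesis curve_avoids : forall x y z (t : R), e x y -> t \in `[0, 1] ->
  `|curve x y t - p z| < r.+3%:R * h -> z \in [set x; y]%SET.
Hypothesis curves_apart : forall x y u v (s t : R),
  e x y -> e u v -> [set x; y]%SET <> [set u; v]%SET -> s \in `[0, 1] -> t \in `[0, 1] ->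
  `|curve x y s - curve u v t| < 3 * h -> exists z, `|curve x y s - p z| < r%:R * h.
Hypothesis curve_step : forall x y (s t : R), e x y -> s \in `[0, 1] -> t \in `[0, 1] ->
  `|s - t| < a -> `|curve x y s - curve x y t| < h.

Lemma mesh_discrete_drawing : exists n (c : T -> pixel n) w, discrete_drawing e r c w.
Proof.
have [ts [ts_path ts_last ts01]] := ex_unit_subdivision a_gt0.
pose center x := lattice h (p x); pose walk x y t := lattice h (curve x y t).
pose points := [seq center x | x <- enum T] ++
  [seq walk z.1 z.2 t | z <- enum {: T * T}, t <- ts].
have [n [f [f_margin f_close]]] := ex_pixel_embedding points r.+2.
have center_in x : center x \in points by rewrite mem_cat map_f ?mem_enum.
have walk0 x y : e x y -> walk x y 0 = center x by rewrite /walk /center => /curve0->.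
have ts01' t : t \in 0 :: ts -> t \in `[0, 1].
  by case/predU1P=> [->|/ts01 //]; rewrite bound_itvE.
have walk_in x y t : e x y -> t \in 0 :: ts -> walk x y t \in points.
  move=> xy /predU1P[->|t_in]; first by rewrite walk0.
  by rewrite mem_cat (allpairs_f (fun z t => walk z.1 z.2 t) (mem_enum _ (x, y))) ?orbT.
have walk_pixel x y q : e x y -> q \in f (center x) :: [seq f (walk x y t) | t <- ts] ->
    exists t, [/\ t \in `[0, 1], q = f (walk x y t) & walk x y t \in points].
  move=> xy; rewrite -(walk0 x y xy) -(map_cons (fun t => f (walk x y t))).
  by case/mapP=> t t_in ->; exists t; split=> //; [exact: ts01' | exact: walk_in].
exists n, (f \o center), (fun x y => [seq f (walk x y t) | t <- ts]); split=> /=.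
- move=> x y xy; rewrite -(walk0 x y xy) path_map.
  apply: (sub_in_path (P := mem (0 :: ts)) _ _ ts_path); last exact/allP.
  move=> s t s_in t_in st; rewrite /= f_close ?walk_in //; apply: lattice_close => //.
  by rewrite mul1r; apply: curve_step; rewrite ?ts01'.
- by move=> x y xy; rewrite -(walk0 x y xy) last_map ts_last /walk curve1.
- move=> x y q xy /(walk_pixel _ _ _ xy)[t [_ -> /f_margin]].
  by rewrite -[r.+2]addn2 => /grid_margin_close; apply; exact: pixel_closexx.
- by move=> x; apply: f_margin.
- move=> x y; rewrite f_close // => /(close_lattice h_gt0); exact: vertices_apart.
- move=> x y z q xy /(walk_pixel _ _ _ xy)[t [t01 -> t_in]].
  by rewrite f_close // => /(close_lattice h_gt0); apply: curve_avoids.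
move=> x y u v q q' xy uv neq /(walk_pixel _ _ _ xy)[s [s01 -> s_in]].
move=> /(walk_pixel _ _ _ uv)[t [t01 -> t_in]]; rewrite f_close //.
move=> /(close_lattice h_gt0)/(curves_apart xy uv neq s01 t01)[z sz].
by exists z; rewrite f_close //; apply: lattice_close.
Qed.

End Mesh.

(* The scale d is small against the distances between vertices and from vertices
   to the curves avoiding them, and the mesh h = d / r is small against the
   distance between curves farther than d from all vertices. *)
Theorem ex_discrete_drawing : exists n r (c : T -> pixel n) w, discrete_drawing e r c w.
Proof.
near (0 : R)^'+ => d0; have d0_gt0 : 0 < d0 by [].
pose d := d0 / 6; have d_gt0 : 0 < d by rewrite divr_gt0.
have d0E : d0 = 6 * d by rewrite mulrC divfK.
near (0 : R)^'+ => eta; have eta_gt0 : 0 < eta by [].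
pose r := (Num.truncn (3 * d / eta)).+1; pose h := d / r%:R.
have r_ge1 : 1 <= r%:R :> R by rewrite ler1n.
have r_gt0 : 0 < r%:R :> R by rewrite ltr0n.
have h_gt0 : 0 < h by rewrite divr_gt0.
have rh : r%:R * h = d by rewrite /h mulrC divfK // gt_eqF.
have h_le_d : h <= d by rewrite ler_pdivrMr // ler_peMr // ltW.
have h_eta : 3 * h <= eta.
  by rewrite /h mulrA ler_pdivrMr // [eta * _]mulrC -ler_pdivrMr // ltW // truncnS_gt.
near (0 : R)^'+ => a; have a_gt0 : 0 < a by [].
have [||||n [c [w cw]]] := @mesh_discrete_drawing r h a h_gt0 a_gt0.
5: by exists n, r, c, w.
- move=> x y xy; suff: `|p x - p y| < d0 by move: x y {xy}; near: d0; exact: vertices_gap.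
  apply: lt_le_trans xy _; rewrite d0E -addn1 !natrD natrM !mulrDl -mulrA rh; lra.
- move=> x y z t xy t01 tz; suff: `|curve x y t - p z| < d0.
    by move: x y z t xy t01 {tz}; near: d0; exact: curve_vertex_gap.
  apply: lt_le_trans tz _; rewrite d0E -addn3 natrD mulrDl rh; lra.
- move=> x y u v s t xy uv neq s01 t01 st; rewrite rh.
  suff: `|curve x y s - curve u v t| < eta.
    by move: x y u v s t xy uv neq s01 t01 {st}; near: eta; exact: curves_meet_gap.
  exact: lt_le_trans st h_eta.
- by near: a; exact: curve_modulus.
Unshelve. all: by end_near. Qed.

End DrawingDiscretization.

(** * Planar graphs without 4-cycles *)

Lemma planar_has_faces (R : realType) (T : finType) (e : rel T) :
  symmetric e -> irreflexive e -> planar R e -> has_faces e.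
Proof.
move=> e_sym e_irr [p [gamma drawing]].
have [n [r [c [w cw]]]] := ex_discrete_drawing drawing.
have [region model] := discrete_drawing_grid_model e_irr cw.
exact: grid_model_has_faces e_sym e_irr model.
Qed.

Lemma planar_subgraph (R : realType) (T T' : finType) (e : rel T) (e' : rel T')
    (i : T' -> T) :
  injective i -> (forall x y, e' x y -> e (i x) (i y)) -> planar R e -> planar R e'.
Proof.
move=> i_inj e'e [p [gamma pd]]; exists (p \o i), (fun x y => gamma (i x) (i y)); split.
- exact: inj_comp (drawing_inj pd) i_inj.
- by move=> x y /e'e; exact: (drawing_continuous pd).
- by move=> x y /e'e; exact: (drawing_simple pd).
- by move=> x y /e'e; exact: (drawing_start pd).
- by move=> x y /e'e; exact: (drawing_end pd).
- by move=> x y /e'e; exact: (drawing_rev pd).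
- by move=> x y z /e'e xy t t01; exact: (drawing_vertex pd xy t01).
move=> x y u v /e'e xy /e'e uv neq; apply: (drawing_disjoint pd xy uv) => E; apply: neq.
by apply: (imset_inj i_inj); rewrite !imsetU1 !imset_set1.
Qed.

Lemma planar_hereditary_faces (R : realType) (T : finType) (e : rel T) :
  irreflexive e -> planar R e -> hereditary_faces e.
Proof.
move=> e_irr e_planar T' i e' i_inj e'_sym e'e.
apply: planar_has_faces e'_sym _ (planar_subgraph i_inj e'e e_planar) => x.
by apply/negP => /e'e; rewrite e_irr.
Qed.

Lemma no_4cycle_C4_free (T : finType) (e : rel T) :
  irreflexive e -> ~ has_cycle 4 e -> C4_free e.
Proof.
move=> e_irr noC4 x y z w xy yz zw wx xz; apply: contra_notT noC4 => yw.
have neq := irreflexive_neq e_irr; exists [tuple x; y; z; w].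
rewrite /ucycle /= xy yz zw wx /= !inE !negb_or.
by rewrite (neq _ _ xy) xz (eq_sym x) (neq _ _ wx) (neq _ _ yz) yw (neq _ _ zw).
Qed.

Lemma defective_colorable_bool (T : finType) (e : rel T) (k : nat) (c : T -> bool) :
  (forall u, #|[set y in nbrs e u | c y == c u]| <= k) -> defective_colorable k k e.
Proof.
move=> c_deg; have class_deg b : induced_max_degree e [set x | c x == b] <= k.
  apply/bigmax_leqP => x; rewrite inE => /eqP xb; apply: leq_trans (c_deg x).
  by apply/subset_leq_card/subsetP => y; rewrite !inE xb andbC.
exists [set x | c x == true], [set x | c x == false]; split=> //;
  by apply/setP => x; rewrite !inE; case: (c x).
Qed.

Theorem theorem2p3 (R : realType) (T : finType) (e : rel T)
    (e_sym : symmetric e) (e_irr : irreflexive e)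
    (e_planar : planar R e) (e_noC4 : ~ has_cycle 4 e) :
  defective_colorable 5 5 e.
Proof.
have e_C4 := no_4cycle_C4_free e_irr e_noC4.
have e_faces := planar_hereditary_faces e_irr e_planar.
have [c c_deg] := hereditary_faces_coloring e_sym e_irr e_C4 e_faces.
exact: defective_colorable_bool c_deg.
Qed.
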